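(* For each complex-valued measurable function $b$ on $\mathbb T$ with $\operatorname{ess\,sup}_{z\in\mathbb T}|b(z)|^2<\frac12$, there is a unique measurable function $a$ on $\mathbb T$ such that $(a,b)\in\mathbf B$.
   Context: $\mathbb T$ is the unit circle, $\mathbb D$ the open unit disc, $\mathbb D^*=\{\overline z^{-1}:z\in\mathbb D\}\cup\{\infty\}$, $a^*(z)=\overline{a(\overline z^{-1})}$. $H^2(\mathbb D)$: functions in $L^2(\mathbb T)$ with vanishing negative Fourier coefficients; $H^2(\mathbb D^* )$: $f$ with $f^*\in H^2(\mathbb D)$; such $f$ extends analytically to $\mathbb D^*$ and $f(\infty)=\overline{f^*(0)}$. $\mathbf L$ is the set of pairs $(a,b)$ of measurable functions on $\mathbb T$ with $aa^*+bb^*=1$ a.e. on $\mathbb T$, $a\in H^2(\mathbb D^* )$ and $a(\infty)>0$. $\mathbf B$ is the set of $(a,b)\in\mathbf L$ with $\inf_{z\in\mathbb D^*}|a(z)|^2>\frac12$ (using the analytic extension of $a$ to $\mathbb D^*$). *)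

(* Defs.v *)
From HB Require Import structures.
From mathcomp Require Import all_boot all_order all_algebra.
From mathcomp Require Import all_classical all_reals all_analysis.
From mathcomp Require Import complex.
From mathcomp Require Import ess_sup_inf.
Set Implicit Arguments. Unset Strict Implicit. Unset Printing Implicit Defensive.
Import Order.TTheory GRing.Theory Num.Theory.
Import numFieldNormedType.Exports.
Local Open Scope classical_set_scope.
Local Open Scope ring_scope.

Section Hardy.
Variable R : realType.

(* Parametrisation of the unit circle T by theta in [0, 2 pi[ :  theta |-> e^{i theta}.
   A "function on T" is a function f : R[i] -> R[i]; only its values on T matter. *)
Definition Tdom : set R := `[0, pi *+ 2[.
Definition eT (t : R) : R[i] := (cos t +i* sin t)%C.

Lemma Tdom_measurable : measurable Tdom.
Proof. exact: measurable_itv. Qed.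

(* normalised-free Lebesgue measure on T (pushed forward from [0, 2 pi[) *)
Definition muT := mrestr (@lebesgue_measure R) Tdom_measurable.

(* measurability of a complex function on T: real and imaginary parts measurable *)
Definition measT (f : R[i] -> R[i]) : Prop :=
  measurable_fun Tdom (fun t => complex.Re (f (eT t))) /\
  measurable_fun Tdom (fun t => complex.Im (f (eT t))).

(* f in L^2(T) *)
Definition L2T (f : R[i] -> R[i]) : Prop :=
  measT f /\
  (\int[@lebesgue_measure R]_(t in Tdom) ((Normc.normc (f (eT t))) ^+ 2)%:E < +oo)%E.

(* n-th Fourier coefficient  (1/2pi) int_0^{2pi} f(e^{it}) e^{-int} dt *)
Definition fourier (f : R[i] -> R[i]) (n : int) : R[i] :=
  ((Rintegral (@lebesgue_measure R) Tdom
       (fun t => complex.Re (f (eT t) * eT (- (n%:~R * t))))) +i*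
   (Rintegral (@lebesgue_measure R) Tdom
       (fun t => complex.Im (f (eT t) * eT (- (n%:~R * t))))))%C / ((pi *+ 2)%:C)%C.

(* H^2(D) : L^2 functions with vanishing negative Fourier coefficients *)
Definition H2D (f : R[i] -> R[i]) : Prop :=
  L2T f /\ forall n : int, n < 0 -> fourier f n = 0.

(* a^*(z) = conj (a (conj(z)^-1)) *)
Definition star (f : R[i] -> R[i]) : R[i] -> R[i] := fun z => (f ((z^*)^-1))^*.

(* H^2(D^* ) : f with f^* in H^2(D) *)
Definition H2Dstar (f : R[i] -> R[i]) : Prop := H2D (star f).

(* Analytic extension of g in H^2(D) to the open disc: sum_{n>=0} ghat(n) z^n
   (limit of the partial sums, real and imaginary parts taken separately). *)
Definition partial_ext (g : R[i] -> R[i]) (z : R[i]) (N : nat) : R[i] :=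
  \sum_(0 <= n < N) fourier g n%:Z * z ^+ n.
Definition extD (g : R[i] -> R[i]) (z : R[i]) : R[i] :=
  (limn (fun N => complex.Re (partial_ext g z N)) +i*
  limn (fun N => complex.Im (partial_ext g z N)))%C.

(* Points of D^* : [None] is infinity, [Some w] with |w| > 1 is w = conj(z)^-1, z in D\{0} *)
Definition Dstar : set (option R[i]) :=
  [set p | match p with None => True | Some w => 1 < Normc.normc w end].

(* Analytic extension of f in H^2(D^* ) to D^*:  f(w) = conj (f^*(conj(w)^-1)),
   f(infinity) = conj (f^*(0)). *)
Definition extDstar (f : R[i] -> R[i]) (p : option R[i]) : R[i] :=
  match p with
  | None => (extD (star f) 0)^*
  | Some w => (extD (star f) ((w^*)^-1))^*
  end.

(* the set L *)
Definition inL (a b : R[i] -> R[i]) : Prop :=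
  {ae @lebesgue_measure R, forall t, Tdom t ->
     a (eT t) * star a (eT t) + b (eT t) * star b (eT t) = 1} /\
  H2Dstar a /\ 0 < extDstar a None.

(* the set B *)
Definition inB (a b : R[i] -> R[i]) : Prop :=
  inL a b /\ 1 / 2 < inf [set Normc.normc (extDstar a p) ^+ 2 | p in Dstar].

End Hardy.

(* Main.v *)
Require Import Defs.
From HB Require Import structures.
From mathcomp Require Import all_boot all_order all_algebra.
From mathcomp Require Import all_classical all_reals all_analysis.
From mathcomp Require Import complex.
From mathcomp Require Import ess_sup_inf measurable_realfun.
From mathcomp Require Import ring lra.
Import Order.TTheory GRing.Theory Num.Theory.
Import numFieldNormedType.Exports.
Local Open Scope classical_set_scope.
Local Open Scope ring_scope.

(* Write w = 1 - |b|^2, so that w lies between some delta > 1/2 and 1, and let h minimise the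
   integral of w |k|^2 over the functions k in H^2(D) with mean value 1 (Szego's extremal
   problem; the minimum s^2 is attained because L^2 is complete).  The variation of the
   minimum says that w h is orthogonal to all v in H^2(D) of mean 0.  Taking v = e^(int) h,
   all nonzero Fourier coefficients of w |h|^2 vanish, hence w |h|^2 = s^2, and
   A = conj(w h) / s belongs to H^2(D), satisfies |A|^2 = w and A h = s on the circle, and
   A(0) = s.  Orthogonality to the difference quotients of h gives A(z) h(z) = s in D, and
   the Poisson integral bounds |h(z)|^2 by s^2 / delta, so |A(z)|^2 >= delta: take a = A^*.

   Conversely let G in H^2(D) with |G|^2 = w, G(0) > 0 and |G| bounded below in D.  The Abel
   means of the Fourier series of G give polynomials p close to G in L^2, with p(0) = G(0),
   and without zeros in the closed disc; hence p(0)/p is a competitor, and its energy tends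
   to G(0)^2, so s <= G(0).  On the other hand the weighted distance of h to G(0) / G has
   square s^2 - G(0)^2.  Therefore G h = s and G = A. *)

(** The explicit outer function, the exponential of log W plus i times its harmonic conjugate (W the
    square root of w), would call for conjugate functions and boundary limits. The extremal problem
    replaces them by Hilbert space arguments: as w is bounded below, the weighted norm is equivalent
    to the plain one, so the minimiser lies in H^2(D) itself. The main analytic inputs are the
    completeness of L^2 and the fact that an integrable function with all Fourier coefficients zero
    vanishes almost everywhere.

    The modulus on the circle alone does not determine G, since an inner factor could be multiplied
    in. The lower bound in D excludes such factors because it makes 1 / G a limit of competitors,
    and G(0) > 0 fixes the unimodular constant. The obstacle is to get at 1 / G: partial sums of G
    may vanish in the disc. Dilating to G(r z) before truncating gives uniform approximation on the
    closed disc, and the reciprocal of a polynomial without zeros there is a product of geometric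
    series. *)

Set Implicit Arguments. Unset Strict Implicit. Unset Printing Implicit Defensive.

(** * Complex arithmetic and the parametrisation of the circle *)

Section ComplexAux.
Context {R : realType}.
Local Notation C := R[i].
Local Notation normc := (@Normc.normc R).
Implicit Types (z w : C) (x : R).

Lemma sqr_normc z : normc z ^+ 2 = complex.Re z ^+ 2 + complex.Im z ^+ 2.
Proof. by case: z => x y; rewrite /= sqr_sqrtr// addr_ge0// sqr_ge0. Qed.

Lemma normc_ge0 z : 0 <= normc z.
Proof. by case: z => x y /=; rewrite sqrtr_ge0. Qed.

Lemma normc_eq0 z : (normc z == 0) = (z == 0).
Proof.
apply/eqP/eqP => [|->]; first exact: Normc.eq0_normc.
by rewrite Normc.normc0.
Qed.

Lemma normc_gt0 z : (0 < normc z) = (z != 0).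
Proof. by rewrite lt_def normc_eq0 normc_ge0 andbT. Qed.

Lemma normcX z n : normc (z ^+ n) = normc z ^+ n.
Proof.
by elim: n => [|n ih]; rewrite ?expr0 ?Normc.normc1// !exprS Normc.normcM ih.
Qed.

Lemma normc_real x : normc (x%:C)%C = `|x|.
Proof. by rewrite /= expr0n addr0 sqrtr_sqr. Qed.

Lemma normcJ z : normc (z^*)%C = normc z.
Proof. by case: z => x y /=; rewrite sqrrN. Qed.

Lemma normcB z w : normc (z - w) = normc (w - z).
Proof. by rewrite -normcN opprB. Qed.

Lemma ReD z w : complex.Re (z + w) = complex.Re z + complex.Re w.
Proof. by case: z; case: w. Qed.
Lemma ImD z w : complex.Im (z + w) = complex.Im z + complex.Im w.
Proof. by case: z; case: w. Qed.
Lemma ReN z : complex.Re (- z) = - complex.Re z. Proof. by case: z. Qed.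
Lemma ImN z : complex.Im (- z) = - complex.Im z. Proof. by case: z. Qed.
Lemma ReM z w : complex.Re (z * w) =
  complex.Re z * complex.Re w - complex.Im z * complex.Im w.
Proof. by case: z; case: w. Qed.
Lemma ImM z w : complex.Im (z * w) =
  complex.Re z * complex.Im w + complex.Im z * complex.Re w.
Proof. by case: z; case: w. Qed.
Lemma ReJ z : complex.Re (z^*)%C = complex.Re z. Proof. by case: z. Qed.
Lemma ImJ z : complex.Im (z^*)%C = - complex.Im z. Proof. by case: z. Qed.
Lemma ReV z : complex.Re z^-1 = complex.Re z / normc z ^+ 2.
Proof. by rewrite sqr_normc; case: z. Qed.
Lemma ImV z : complex.Im z^-1 = - complex.Im z / normc z ^+ 2.
Proof. by rewrite sqr_normc mulNr; case: z. Qed.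

Definition ReImE := (ReD, ImD, ReN, ImN, ReM, ImM, ReJ, ImJ).

Lemma eqc z w :
  complex.Re z = complex.Re w -> complex.Im z = complex.Im w -> z = w.
Proof. by case: z w => a b [c d] /= -> ->. Qed.

Lemma mulcJ z : z * (z^*)%C = ((normc z ^+ 2)%:C)%C.
Proof. by apply: eqc; rewrite ?sqr_normc !ReImE /=; ring. Qed.

Lemma conjcD z w : ((z + w)^*)%C = (z^*)%C + (w^*)%C.
Proof. by apply: eqc; rewrite !ReImE// opprD. Qed.
Lemma conjcB z w : ((z - w)^*)%C = (z^*)%C - (w^*)%C.
Proof. by apply: eqc; rewrite !ReImE// opprD. Qed.
Lemma conjcM z w : ((z * w)^*)%C = (z^*)%C * (w^*)%C.
Proof. by apply: eqc; rewrite !ReImE; ring. Qed.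

Lemma conjcX z n : ((z ^+ n)^*)%C = (z^*)%C ^+ n.
Proof. by elim: n => [|n ih]; rewrite ?expr0 ?conjc1// !exprS conjcM ih. Qed.

Lemma normRe z : `|complex.Re z| <= normc z.
Proof.
rewrite -(ler_sqr (normr_ge0 _) (normc_ge0 _)) real_normK ?num_real//.
by rewrite sqr_normc lerDl sqr_ge0.
Qed.

Lemma normIm z : `|complex.Im z| <= normc z.
Proof.
rewrite -(ler_sqr (normr_ge0 _) (normc_ge0 _)) real_normK ?num_real//.
by rewrite sqr_normc lerDr sqr_ge0.
Qed.

Lemma normc_le_ReIm z : normc z <= `|complex.Re z| + `|complex.Im z|.
Proof.
rewrite -(ler_sqr (normc_ge0 _)) ?nnegrE ?addr_ge0//.
rewrite sqr_normc sqrrD !real_normK ?num_real//.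
by rewrite -addrA lerD2l lerDr mulrn_wge0// mulr_ge0.
Qed.

Lemma sqr_normcD z w : normc (z + w) ^+ 2 =
  normc z ^+ 2 + 2 * complex.Re (z * (w^*)%C) + normc w ^+ 2.
Proof. by rewrite !sqr_normc !ReImE; ring. Qed.

Lemma sqr_normcD_le z w :
  normc (z + w) ^+ 2 <= 2 * normc z ^+ 2 + 2 * normc w ^+ 2.
Proof.
rewrite !sqr_normc !ReImE.
have h1 := sqr_ge0 (complex.Re z - complex.Re w).
have h2 := sqr_ge0 (complex.Im z - complex.Im w); nra.
Qed.

Lemma normc_eT x : normc (eT x) = 1.
Proof. by rewrite /eT /= cos2Dsin2 sqrtr1. Qed.

Lemma eT_neq0 x : eT x != 0.
Proof. by rewrite -normc_gt0 normc_eT. Qed.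

Lemma eT_conj x : ((eT x)^*)%C = (eT x)^-1.
Proof.
by apply: eqc; rewrite ?ReV ?ImV ?ReJ ?ImJ normc_eT expr1n divr1.
Qed.

Lemma eTD x y : eT (x + y) = eT x * eT y.
Proof. by rewrite /eT cosD sinD; apply: eqc; rewrite !ReImE/= //; ring. Qed.

Lemma eTN x : eT (- x) = (eT x)^-1.
Proof. by rewrite -eT_conj /eT cosN sinN. Qed.

Lemma eT_mulrn x n : eT (n%:R * x) = eT x ^+ n.
Proof.
elim: n => [|n ih]; first by rewrite mul0r expr0 /eT cos0 sin0.
by rewrite -natr1 mulrDl mul1r eTD ih exprSr.
Qed.

(** From cos (x - y) = 1 the sine of half the difference vanishes, whereas |x - y| / 2 would lie
    strictly between 0 and pi. This lets [circle_fun] recover the angle from the point. *)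
Lemma eT_inj : {in `[0, pi *+ 2[ &, injective (@eT R)}.
Proof.
move=> x y; rewrite !in_itv/= => /andP[x0 x2] /andP[y0 y2] exy.
have /(congr1 (@complex.Re R)) : eT (x - y) = 1.
  by rewrite eTD eTN exy divff// eT_neq0.
rewrite /eT/= => c1; apply/eqP; rewrite -subr_eq0; apply/negPn/negP => xy0.
have : sin ((x - y) / 2) = 0.
  apply/eqP; rewrite -sqrf_eq0 sin2cos2.
  by rewrite (_ : x - y = (x - y) / 2 *+ 2) ?cos_mulr2n in c1; [apply/eqP; lra|lra].
have : 0 < `|x - y| / 2 < pi.
  rewrite divr_gt0 ?normr_gt0//= ltr_pdivrMr// mulr_natr.
  by rewrite ltr_norml; apply/andP; split; lra.
move/sin_gt0_pi; case: (ger0P (x - y)) => _; first by move=> + s0; rewrite s0 ltxx.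
by rewrite mulNr sinN oppr_gt0 => + s0; rewrite s0 ltxx.
Qed.

End ComplexAux.

(** * Square-integrable functions on the circle *)

Section L2.
Context {R : realType}.
Local Notation C := R[i].
Local Notation normc := (@Normc.normc R).
Local Notation mu := (@lebesgue_measure R).
Local Notation D := (@Tdom R).
Local Notation Re := (@complex.Re R).
Local Notation Im := (@complex.Im R).
Local Notation rint g := (mu.-integrable D (EFin \o g)).
Implicit Types (f g : R -> C) (u v : R -> R) (c : C) (M : R).

Lemma measurable_D : measurable D. Proof. exact: Tdom_measurable. Qed.
Hint Resolve measurable_D : core.

Lemma mu_Tdom : mu D = (pi *+ 2)%:E.
Proof.
rewrite /Tdom lebesgue_measure_itv/= lte_fin pmulrn_lgt0// pi_gt0.
by rewrite sube0.
Qed.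

Lemma aeS (P Q : R -> Prop) : {ae mu, forall t, D t -> P t} ->
  (forall t, D t -> P t -> Q t) -> {ae mu, forall t, D t -> Q t}.
Proof.
have F := @ae_filter_ringOfSetsType _ _ _ mu.
by move=> h PQ; apply: filterS h => t h Dt; exact/PQ/h.
Qed.

Lemma aeI (P Q : R -> Prop) : {ae mu, forall t, D t -> P t} ->
  {ae mu, forall t, D t -> Q t} -> {ae mu, forall t, D t -> P t /\ Q t}.
Proof.
have F := @ae_filter_ringOfSetsType _ _ _ mu.
by move=> hP hQ; apply: filterS2 hP hQ => t hP hQ Dt; split; [exact: hP|exact: hQ].
Qed.

Lemma pi2_gt0 : 0 < pi *+ 2 :> R.
Proof. by rewrite pmulrn_lgt0// pi_gt0. Qed.

Lemma rint_dom u v : measurable_fun D u -> rint v ->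
  (forall t, D t -> `|u t| <= v t) -> rint u.
Proof.
move=> mu_ iv uv; apply: (@le_integrable _ _ _ mu D measurable_D _ (EFin \o v) _ _ iv).
  exact/measurable_EFinP.
by move=> t Dt /=; rewrite lee_fin (le_trans (uv _ Dt))// ler_norm.
Qed.

Lemma rint_meas u : rint u -> measurable_fun D u.
Proof. by move=> /(measurable_int mu)/measurable_EFinP. Qed.

Lemma rint_cst M : rint (fun=> M).
Proof.
apply/integrableP; split; first exact/measurable_EFinP/measurable_cst.
by rewrite (eq_integral (fun=> `|M|%:E))// integral_cst//= mu_Tdom -EFinM ltry.
Qed.

Lemma rintD u v : rint u -> rint v -> rint (fun t => u t + v t).
Proof. by move=> iu iv; exact: (@integrableD _ _ _ mu D measurable_D (EFin \o u) (EFin \o v) iu iv). Qed.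

Lemma rintZ M u : rint u -> rint (fun t => M * u t).
Proof. by move=> iu; exact: (@integrableZl _ _ _ mu D measurable_D M (EFin \o u) iu). Qed.

Lemma rintN u : rint u -> rint (fun t => - u t).
Proof.
move=> /(rintZ (-1)).
by rewrite (_ : (fun _ => _) = (fun t => - u t))//; apply/funext => t; rewrite mulN1r.
Qed.

Lemma rint_norm u : rint u -> rint (fun t => `|u t|).
Proof.
move=> iu; have := integrable_norm iu.
by apply: eq_integrable.
Qed.

Definition avg u : R := Rintegral mu D u / (pi *+ 2).

Lemma eq_avg u v : (forall t, D t -> u t = v t) -> avg u = avg v.
Proof.
move=> uv; rewrite /avg; congr (_ / _).
by apply: eq_Rintegral => t /set_mem; exact: uv.
Qed.

Lemma ae_eq_avg u v : measurable_fun D u -> measurable_fun D v ->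
  {ae mu, forall t, D t -> u t = v t} -> avg u = avg v.
Proof.
move=> mu_ mv uv; rewrite /avg /Rintegral; congr (fine _ / _).
apply: ae_eq_integral => //; try exact/measurable_EFinP.
by apply: (aeS uv) => t _ /= ->.
Qed.

Lemma avgD u v : rint u -> rint v -> avg (fun t => u t + v t) = avg u + avg v.
Proof. by move=> iu iv; rewrite /avg RintegralD// mulrDl. Qed.

Lemma avgZ M u : rint u -> avg (fun t => M * u t) = M * avg u.
Proof. by move=> iu; rewrite /avg RintegralZl// mulrA. Qed.

Lemma avgN u : rint u -> avg (fun t => - u t) = - avg u.
Proof.
move=> iu; rewrite -mulN1r -avgZ//; apply: eq_avg => t _.
by rewrite mulN1r.
Qed.

Lemma avgB u v : rint u -> rint v -> avg (fun t => u t - v t) = avg u - avg v.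
Proof. by move=> iu iv; rewrite avgD ?avgN//; exact: rintN. Qed.

Lemma avg_cst M : avg (fun=> M) = M.
Proof. by rewrite /avg Rintegral_cst//= mu_Tdom/= mulfK// gt_eqF// pi2_gt0. Qed.

Lemma avg_ge0 u : (forall t, D t -> 0 <= u t) -> 0 <= avg u.
Proof. by move=> u0; rewrite divr_ge0 ?Rintegral_ge0// ltW// pi2_gt0. Qed.

Lemma le_avg u v : rint u -> rint v -> (forall t, D t -> u t <= v t) ->
  avg u <= avg v.
Proof.
move=> iu iv uv; rewrite ler_wpM2r ?invr_ge0 ?(ltW pi2_gt0)//.
exact: le_Rintegral.
Qed.

Lemma avg_eq0 u : rint u -> (forall t, D t -> 0 <= u t) -> avg u = 0 ->
  {ae mu, forall t, D t -> u t = 0}.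
Proof.
move=> iu u0 /eqP; rewrite mulf_eq0 invr_eq0 (gt_eqF pi2_gt0) orbF => /eqP i0.
have mu_ : measurable_fun D (EFin \o u) by apply: measurable_int iu.
have : (\int[mu]_(x in D) `|(EFin \o u) x| = 0)%E.
  transitivity (\int[mu]_(x in D) (u x)%:E)%E.
    by apply: eq_integral => t /set_mem Dt /=; rewrite ger0_norm// u0.
  by rewrite -[LHS]fineK ?integrable_fin_num// -/(Rintegral _ _ _) i0.
move/(ae_eq_integral_abs mu measurable_D mu_).1.
by apply: filterS => t h Dt; have /= := h Dt; case.
Qed.

Definition cmeas f := measurable_fun D (fun t => Re (f t)) /\
  measurable_fun D (fun t => Im (f t)).

Lemma cmeas_cst c : cmeas (fun=> c).
Proof. by split; exact: measurable_cst. Qed.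

Lemma cmeasD f g : cmeas f -> cmeas g -> cmeas (fun t => f t + g t).
Proof.
move=> [f1 f2] [g1 g2]; split.
  by under eq_fun do rewrite ReD; exact: measurable_funD.
by under eq_fun do rewrite ImD; exact: measurable_funD.
Qed.

Lemma cmeasM f g : cmeas f -> cmeas g -> cmeas (fun t => f t * g t).
Proof.
move=> [f1 f2] [g1 g2]; split.
  under eq_fun do rewrite ReM.
  by apply: measurable_funB; exact: measurable_funM.
under eq_fun do rewrite ImM.
by apply: measurable_funD; exact: measurable_funM.
Qed.

Lemma cmeasN f : cmeas f -> cmeas (fun t => - f t).
Proof.
move=> mf; under eq_fun do rewrite -mulN1r.
by apply: cmeasM => //; exact: cmeas_cst.
Qed.

Lemma cmeasB f g : cmeas f -> cmeas g -> cmeas (fun t => f t - g t).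
Proof. by move=> mf mg; apply: cmeasD => //; exact: cmeasN. Qed.

Lemma measurable_funN' u : measurable_fun D u -> measurable_fun D (fun t => - u t).
Proof.
move=> m; under eq_fun do rewrite -mulN1r.
by apply: measurable_funM => //; exact: measurable_cst.
Qed.

Lemma cmeasJ f : cmeas f -> cmeas (fun t => (f t)^*%C).
Proof.
move=> [f1 f2]; split; first by under eq_fun do rewrite ReJ.
by under eq_fun do rewrite ImJ; exact: measurable_funN'.
Qed.

Lemma cmeas_normc2 f : cmeas f -> measurable_fun D (fun t => normc (f t) ^+ 2).
Proof.
move=> [f1 f2]; under eq_fun do rewrite sqr_normc.
by apply: measurable_funD; exact: measurable_funX.
Qed.

Lemma cmeas_normc f : cmeas f -> measurable_fun D (fun t => normc (f t)).
Proof.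
move=> /cmeas_normc2 mf.
rewrite (_ : (fun _ => _) = Num.sqrt \o (fun t => normc (f t) ^+ 2)).
  apply: measurableT_comp => //; apply: continuous_measurable_fun.
  by move=> x; exact: sqrt_continuous.
by apply/funext => t /=; rewrite sqrtr_sqr ger0_norm// normc_ge0.
Qed.

(** Inversion is continuous off 0, and on the singleton of 0 every function is measurable, whatever
    the default value there. *)
Lemma measurable_inv : measurable_fun [set: R] (@GRing.inv R).
Proof.
rewrite -(setUv [set 0]) setUC; apply/measurable_funU => //.
- exact: measurableC.
split; last exact: measurable_fun_set1.
apply: open_continuous_measurable_fun; first exact: closed_openC.
by move=> x /set_mem/= /eqP x0; exact: inv_continuous.
Qed.

Lemma cmeasV f : cmeas f -> cmeas (fun t => (f t)^-1).
Proof.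
move=> mf; have mi : measurable_fun D (fun t => (normc (f t) ^+ 2)^-1).
  apply: (@measurableT_comp _ _ _ _ _ _ (@GRing.inv R)); first exact: measurable_inv.
  exact: cmeas_normc2.
case: mf => f1 f2; split.
  by under eq_fun do rewrite ReV; exact: measurable_funM.
under eq_fun do rewrite ImV.
by apply: measurable_funM => //; exact: measurable_funN'.
Qed.

Lemma cmeas_real u : measurable_fun D u -> cmeas (fun t => (u t)%:C%C).
Proof. by move=> m; split => //; exact: measurable_cst. Qed.

Lemma cmeas_eT : cmeas (@eT R).
Proof.
by split; apply: measurable_funTS; apply: continuous_measurable_fun => x;
  [exact: continuous_cos|exact: continuous_sin].
Qed.

Lemma cmeasX f n : cmeas f -> cmeas (fun t => f t ^+ n).
Proof.
move=> mf; elim: n => [|n ih].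
  by under eq_fun do rewrite expr0; exact: cmeas_cst.
by under eq_fun do rewrite exprS; exact: cmeasM.
Qed.

Definition L1 f := rint (fun t => Re (f t)) /\ rint (fun t => Im (f t)).

Lemma L1_meas f : L1 f -> cmeas f.
Proof. by move=> [/rint_meas ? /rint_meas]. Qed.

Lemma L1_dom f u : cmeas f -> rint u -> (forall t, D t -> normc (f t) <= u t) ->
  L1 f.
Proof.
move=> [f1 f2] iu fu; split; apply: (rint_dom _ iu) => // t Dt.
  by rewrite (le_trans (normRe _))// fu.
by rewrite (le_trans (normIm _))// fu.
Qed.

Lemma rint_normc f : L1 f -> rint (fun t => normc (f t)).
Proof.
move=> f1; apply: (@rint_dom _ (fun t => `|Re (f t)| + `|Im (f t)|)).
- by apply: cmeas_normc; exact: L1_meas.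
- by apply: rintD; apply: rint_norm; case: f1.
- by move=> t _; rewrite ger0_norm ?normc_ge0// normc_le_ReIm.
Qed.

Lemma L1M_bounded f g M : cmeas g -> (forall t, D t -> normc (g t) <= M) ->
  L1 f -> L1 (fun t => f t * g t).
Proof.
move=> mg gM f1; apply: (@L1_dom _ (fun t => M * normc (f t))).
- by apply: cmeasM => //; exact: L1_meas.
- exact/rintZ/rint_normc.
- move=> t Dt; rewrite Normc.normcM mulrC ler_wpM2r ?normc_ge0//; exact: gM.
Qed.

Lemma L1D f g : L1 f -> L1 g -> L1 (fun t => f t + g t).
Proof.
by move=> [f1 f2] [g1 g2]; split; [under eq_fun do rewrite ReD|
  under eq_fun do rewrite ImD]; exact: rintD.
Qed.

Lemma L1Z c f : L1 f -> L1 (fun t => c * f t).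
Proof.
move=> f1; under eq_fun do rewrite mulrC.
by apply: (@L1M_bounded _ _ (normc c)) => //; exact: cmeas_cst.
Qed.

Lemma L1N f : L1 f -> L1 (fun t => - f t).
Proof. by move=> f1; under eq_fun do rewrite -mulN1r; exact: L1Z. Qed.

Lemma L1B f g : L1 f -> L1 g -> L1 (fun t => f t - g t).
Proof. by move=> f1 g1; apply: L1D => //; exact: L1N. Qed.

Lemma L1J f : L1 f -> L1 (fun t => (f t)^*%C).
Proof.
move=> [f1 f2]; split; first by under eq_fun do rewrite ReJ.
by under eq_fun do rewrite ImJ; exact: rintN.
Qed.

Lemma L1_real u : rint u -> L1 (fun t => (u t)%:C%C).
Proof. by move=> iu; split => //; exact: rint_cst. Qed.

Lemma L1_cst c : L1 (fun=> c).
Proof. by split; exact: rint_cst. Qed.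

Definition mean f : C := (avg (fun t => Re (f t)) +i* avg (fun t => Im (f t)))%C.

Lemma eq_mean f g : (forall t, D t -> f t = g t) -> mean f = mean g.
Proof. by move=> fg; congr Complex; apply: eq_avg => t Dt; rewrite fg. Qed.

Lemma ae_eq_mean f g : cmeas f -> cmeas g ->
  {ae mu, forall t, D t -> f t = g t} -> mean f = mean g.
Proof.
move=> [f1 f2] [g1 g2] fg; congr Complex; apply: ae_eq_avg => //;
by apply: (aeS fg) => t _ ->.
Qed.

Lemma meanD f g : L1 f -> L1 g -> mean (fun t => f t + g t) = mean f + mean g.
Proof.
move=> [f1 f2] [g1 g2]; apply: eqc; rewrite !ReImE/= -avgD//;
by apply: eq_avg => t _; rewrite ReImE.
Qed.

Lemma meanZ c f : L1 f -> mean (fun t => c * f t) = c * mean f.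
Proof.
move=> [f1 f2]; apply: eqc; rewrite !ReImE/= -!avgZ// -?avgB -?avgD//;
  try exact: rintZ; by apply: eq_avg => t _; rewrite ReImE.
Qed.

Lemma meanN f : L1 f -> mean (fun t => - f t) = - mean f.
Proof.
move=> f1; rewrite -mulN1r -meanZ//; apply: eq_mean => t _.
by rewrite mulN1r.
Qed.

Lemma meanB f g : L1 f -> L1 g -> mean (fun t => f t - g t) = mean f - mean g.
Proof. by move=> f1 g1; rewrite meanD ?meanN//; exact: L1N. Qed.

Lemma meanJ f : L1 f -> mean (fun t => (f t)^*%C) = ((mean f)^*)%C.
Proof.
move=> [f1 f2]; apply: eqc; rewrite !ReImE/= -?avgN//;
by apply: eq_avg => t _; rewrite ReImE.
Qed.

Lemma mean_cst c : mean (fun=> c) = c.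
Proof. by apply: eqc; rewrite /= avg_cst. Qed.

Lemma mean_real u : mean (fun t => (u t)%:C%C) = ((avg u)%:C)%C.
Proof. by apply: eqc => //=; rewrite avg_cst. Qed.

Lemma mean_sum n (F : nat -> R -> C) : (forall i, L1 (F i)) ->
  L1 (fun t => \sum_(0 <= i < n) F i t) /\
  mean (fun t => \sum_(0 <= i < n) F i t) = \sum_(0 <= i < n) mean (F i).
Proof.
move=> F1; elim: n => [|n [ih1 ih2]].
  rewrite big_geq//; under [X in mean X]eq_fun do rewrite big_geq//.
  by under eq_fun do rewrite big_geq//; split; [exact: L1_cst|rewrite mean_cst].
rewrite big_nat_recr//= -ih2 -meanD//; split.
  by under eq_fun do rewrite big_nat_recr//=; exact: L1D.
by apply: eq_mean => t _; rewrite big_nat_recr.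
Qed.

Definition L2 f := cmeas f /\ rint (fun t => normc (f t) ^+ 2).

Definition nrm2 f : R := avg (fun t => normc (f t) ^+ 2).

Lemma nrm2_ge0 f : 0 <= nrm2 f.
Proof. by apply: avg_ge0 => t _; rewrite sqr_ge0. Qed.

Lemma L2_dom f u : cmeas f -> rint u ->
  (forall t, D t -> normc (f t) ^+ 2 <= u t) -> L2 f.
Proof.
move=> mf iu fu; split=> //; apply: (rint_dom _ iu); first exact: cmeas_normc2.
by move=> t Dt; rewrite ger0_norm ?sqr_ge0// fu.
Qed.

Lemma L2_bounded f M : cmeas f -> (forall t, D t -> normc (f t) <= M) -> L2 f.
Proof.
move=> mf fM; apply: (@L2_dom _ (fun=> M ^+ 2)) => //; first exact: rint_cst.
by move=> t Dt; rewrite lerXn2r// ?nnegrE ?normc_ge0 ?fM// (le_trans _ (fM _ Dt)) ?normc_ge0.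
Qed.

Lemma L2_cst c : L2 (fun=> c).
Proof. by apply: (@L2_bounded _ (normc c)) => //; exact: cmeas_cst. Qed.

Lemma L2D f g : L2 f -> L2 g -> L2 (fun t => f t + g t).
Proof.
move=> [mf f2] [mg g2].
apply: (@L2_dom _ (fun t => 2 * normc (f t) ^+ 2 + 2 * normc (g t) ^+ 2)).
- exact: cmeasD.
- by apply: rintD; exact: rintZ.
- by move=> t _; exact: sqr_normcD_le.
Qed.

Lemma L2M_bounded f g M : cmeas g -> (forall t, D t -> normc (g t) <= M) ->
  L2 f -> L2 (fun t => f t * g t).
Proof.
move=> mg gM [mf f2]; apply: (@L2_dom _ (fun t => M ^+ 2 * normc (f t) ^+ 2)).
- exact: cmeasM.
- exact: rintZ.
- move=> t Dt; rewrite Normc.normcM exprMn mulrC ler_wpM2r ?sqr_ge0//.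
  by rewrite lerXn2r// ?nnegrE ?normc_ge0 ?gM// (le_trans _ (gM _ Dt)) ?normc_ge0.
Qed.

Lemma L2Z c f : L2 f -> L2 (fun t => c * f t).
Proof.
move=> f2; under eq_fun do rewrite mulrC.
by apply: (@L2M_bounded _ _ (normc c)) => //; exact: cmeas_cst.
Qed.

Lemma L2N f : L2 f -> L2 (fun t => - f t).
Proof. by move=> f2; under eq_fun do rewrite -mulN1r; exact: L2Z. Qed.

Lemma L2B f g : L2 f -> L2 g -> L2 (fun t => f t - g t).
Proof. by move=> f2 g2; apply: L2D => //; exact: L2N. Qed.

Lemma L2J f : L2 f -> L2 (fun t => (f t)^*%C).
Proof.
by move=> [mf f2]; split; [exact: cmeasJ|under eq_fun do rewrite normcJ].
Qed.

Lemma L1M f g : L2 f -> L2 g -> L1 (fun t => f t * g t).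
Proof.
move=> [mf f2] [mg g2].
apply: (@L1_dom _ (fun t => normc (f t) ^+ 2 + normc (g t) ^+ 2)).
- exact: cmeasM.
- exact: rintD.
- move=> t _; rewrite Normc.normcM; have := sqr_ge0 (normc (f t) - normc (g t)).
  have := mulr_ge0 (normc_ge0 (f t)) (normc_ge0 (g t)); nra.
Qed.

Lemma L1MJ f g : L2 f -> L2 g -> L1 (fun t => f t * (g t)^*%C).
Proof. by move=> f2 g2; apply: L1M => //; exact: L2J. Qed.

Lemma L2_L1 f : L2 f -> L1 f.
Proof.
move=> f2; have := L1M f2 (L2_cst 1).
by under eq_fun do rewrite mulr1.
Qed.

Lemma eq_nrm2 f g : (forall t, D t -> f t = g t) -> nrm2 f = nrm2 g.
Proof. by move=> fg; apply: eq_avg => t Dt; rewrite fg. Qed.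

Lemma nrm2E f : (nrm2 f)%:C%C = mean (fun t => f t * (f t)^*%C).
Proof. by rewrite -mean_real; apply: eq_mean => t _; rewrite mulcJ. Qed.

Lemma nrm2D f g : L2 f -> L2 g -> nrm2 (fun t => f t + g t) =
  nrm2 f + 2 * Re (mean (fun t => f t * (g t)^*%C)) + nrm2 g.
Proof.
move=> f2 g2; have [fg _] := L1MJ f2 g2; case: f2 g2 => mf f2 [mg g2].
have fg2 := rintZ 2 fg.
rewrite /nrm2 /mean/= -avgZ// -!avgD//; last exact: rintD.
by apply: eq_avg => t _; rewrite sqr_normcD.
Qed.

Lemma nrm2Z c f : L2 f -> nrm2 (fun t => c * f t) = normc c ^+ 2 * nrm2 f.
Proof.
move=> [mf f2]; rewrite /nrm2 -avgZ//; apply: eq_avg => t _.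
by rewrite Normc.normcM exprMn.
Qed.

Lemma nrm2N f : nrm2 (fun t => - f t) = nrm2 f.
Proof. by apply: eq_avg => t _; rewrite normcN. Qed.

Lemma nrm2J f : nrm2 (fun t => (f t)^*%C) = nrm2 f.
Proof. by apply: eq_avg => t _; rewrite normcJ. Qed.

Lemma nrm2_sub f g : nrm2 (fun t => f t - g t) = nrm2 (fun t => g t - f t).
Proof. by apply: eq_avg => t _; rewrite normcB. Qed.

Lemma nrm2_cst c : nrm2 (fun=> c) = normc c ^+ 2.
Proof. by rewrite /nrm2 avg_cst. Qed.

Lemma nrm2M_bounded f g M : cmeas g -> (forall t, D t -> normc (g t) <= M) ->
  L2 f -> nrm2 (fun t => f t * g t) <= M ^+ 2 * nrm2 f.
Proof.
move=> mg gM f2; have [_ fg] := L2M_bounded mg gM f2; case: f2 => mf f2.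
rewrite /nrm2 -avgZ//; apply: le_avg => //; first exact: rintZ.
move=> t Dt; rewrite Normc.normcM exprMn mulrC ler_wpM2r ?sqr_ge0//.
by rewrite lerXn2r// ?nnegrE ?normc_ge0 ?gM// (le_trans _ (gM _ Dt)) ?normc_ge0.
Qed.

Lemma nrm2_eq0 f : L2 f -> nrm2 f = 0 -> {ae mu, forall t, D t -> f t = 0}.
Proof.
move=> [mf f2] /(avg_eq0 f2); have h t : D t -> 0 <= normc (f t) ^+ 2.
  by rewrite sqr_ge0.
move=> /(_ h)/aeS; apply => t _ /eqP.
by rewrite sqrf_eq0 normc_eq0 => /eqP.
Qed.

(** Used with c = - s m for real s, where m is the inner product of f and g: the cross term is then
    real and a quadratic polynomial in s remains. Both [CauchySchwarz] and [minimizer_orthogonal]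
    rest on this choice. *)
Lemma nrm2_variation f g c : L2 f -> L2 g -> nrm2 (fun t => f t + c * g t) =
  nrm2 f + 2 * Re ((c^*)%C * mean (fun t => f t * (g t)^*%C)) +
  normc c ^+ 2 * nrm2 g.
Proof.
move=> f2 g2; rewrite nrm2D//; last exact: L2Z.
rewrite nrm2Z// -meanZ; last exact: L1MJ.
congr (_ + 2 * Re _ + _); apply: eq_mean => t _.
by rewrite rmorphM mulrCA.
Qed.

Lemma CauchySchwarz f g : L2 f -> L2 g ->
  normc (mean (fun t => f t * (g t)^*%C)) ^+ 2 <= nrm2 f * nrm2 g.
Proof.
move=> f2 g2; set m := mean _.
have key s : 0 <= nrm2 f - 2 * s * normc m ^+ 2 + s ^+ 2 * (normc m ^+ 2 * nrm2 g).
  have := nrm2_ge0 (fun t => f t + ((- s)%:C%C * m) * g t).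
  rewrite nrm2_variation// -/m Normc.normcM normc_real normrN exprMn real_normK ?num_real//.
  rewrite (_ : complex.Re _ = - s * normc m ^+ 2); last first.
    by rewrite sqr_normc !ReImE/=; ring.
  by rewrite !mulrA => /le_trans; apply; lra.
have g0 := nrm2_ge0 g; have f0 := nrm2_ge0 f; have m0 := sqr_ge0 (normc m).
have [gp|g00] := ltP 0 (nrm2 g).
  rewrite -ler_pdivrMr// -subr_ge0; have := key (nrm2 g)^-1.
  suff -> : nrm2 f - 2 * (nrm2 g)^-1 * normc m ^+ 2 +
    (nrm2 g)^-1 ^+ 2 * (normc m ^+ 2 * nrm2 g) = nrm2 f - normc m ^+ 2 / nrm2 g by [].
  by field; rewrite gt_eqF.
have {g00}g00 : nrm2 g = 0 by apply/eqP; rewrite eq_le g00.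
rewrite g00 mulr0 leNgt; apply/negP => mp.
(* If g has norm 0, the bound is affine in s, and this s makes it equal to - nrm2 f - 2 < 0. *)
have := key ((nrm2 f + 1) / (normc m ^+ 2)); rewrite g00 !mulr0 addr0.
by rewrite -mulrA divfK ?gt_eqF//; lra.
Qed.

Lemma normc_mean_le f : L2 f -> normc (mean f) ^+ 2 <= nrm2 f.
Proof.
move=> f2; have := CauchySchwarz f2 (L2_cst 1).
rewrite nrm2_cst Normc.normc1 expr1n mulr1.
by congr (normc _ ^+ 2 <= _); apply: eq_mean => t _; rewrite conjc1 mulr1.
Qed.

End L2.

(** * Completeness of L^2 of the circle *)

Section Completeness.
Context {R : realType}.
Local Notation C := R[i].
Local Notation normc := (@Normc.normc R).
Local Notation mu := (@lebesgue_measure R).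
Local Notation D := (@Tdom R).
Local Notation Re := (@complex.Re R).
Local Notation Im := (@complex.Im R).
Local Notation rint g := (mu.-integrable D (EFin \o g)).
Implicit Types (f g : R -> C) (u v : R -> R) (c : C) (M : R).

#[local] Hint Extern 0 (measurable (@Tdom _)) => exact: measurable_D : core.

Lemma integral_avg u : rint u -> (\int[mu]_(t in D) (u t)%:E = (avg u * (pi *+ 2))%:E)%E.
Proof.
move=> iu; rewrite /avg divfK ?gt_eqF ?pi2_gt0// /Rintegral fineK//.
by rewrite integrable_fin_num.
Qed.

Lemma avg_normc_le f : L2 f -> avg (fun t => normc (f t)) ^+ 2 <= nrm2 f.
Proof.
move=> f2; have mf : cmeas (fun t => (normc (f t))%:C%C).
  by apply: cmeas_real; apply: cmeas_normc; case: f2.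
have nn t : normc ((normc (f t))%:C%C) = normc (f t).
  by rewrite normc_real ger0_norm// normc_ge0.
have g2 : L2 (fun t => (normc (f t))%:C%C).
  by case: f2 => _ f2; split => //; under eq_fun do rewrite nn.
apply: (le_trans _ (_ : nrm2 (fun t => (normc (f t))%:C%C) <= _)).
  have := normc_mean_le g2; rewrite mean_real normc_real real_normK//.
  exact: num_real.
by rewrite /nrm2; under [X in avg X <= _]eq_fun do rewrite nn.
Qed.

Lemma limn_einf_le (u : (\bar R)^nat) (x : \bar R) : (forall n, u n <= x)%E ->
  (limn_einf u <= x)%E.
Proof.
move=> ux; rewrite limn_einf_lim; apply: lime_le; first exact: is_cvg_einfs.
apply: nearW => n; apply: le_trans (ux n).
by apply: ereal_inf_lbound; exists n => //=.
Qed.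

Lemma cvg_of_summable_diff (x : R ^nat) (d : R ^nat) :
  (forall n, `|x n.+1 - x n| <= d n) -> cvgn (series d) -> cvgn x.
Proof.
move=> xd sd; have d0 n : 0 <= d n := le_trans (normr_ge0 _) (xd n).
have c : cvgn (series (telescope x)).
  apply: (@normed_cvg _ R^o); apply: series_le_cvg sd => n; rewrite /= ?normr_ge0//; exact: xd.
rewrite (_ : x = (fun n => x 0%N + series (telescope x) n)).
  by apply: is_cvgD => //; exact: is_cvg_cst.
by apply/funext => n; exact: eq_sum_telescope.
Qed.

(** The L^1 norm is at most the L^2 norm for the normalised measure, so by monotone convergence the
    series of the |F (n+1) - F n| has integral at most 2 times 2 pi. It is therefore finite almost
    everywhere, and there the sequence converges absolutely by telescoping. *)
Lemma ae_cvg_of_summable_diff (F : nat -> R -> C) : (forall n, L2 (F n)) ->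
  (forall n, nrm2 (fun t => F n.+1 t - F n t) <= (2^-1 ^+ n) ^+ 2) ->
  {ae mu, forall t, D t -> cvgn (fun n => Re (F n t)) /\ cvgn (fun n => Im (F n t))}.
Proof.
move=> F2 dF; pose d n t := normc (F n.+1 t - F n t).
have B2 n : L2 (fun t => F n.+1 t - F n t) by exact: L2B.
have d1 n : rint (d n) by exact/rint_normc/L2_L1.
have md n : measurable_fun D (EFin \o d n) by apply: measurable_int (d1 n).
have d0 n t : 0 <= d n t by exact: normc_ge0.
have ad n : avg (d n) <= 2^-1 ^+ n.
  rewrite -(ler_sqr) ?nnegrE ?exprn_ge0// ?avg_ge0//.
  by apply: le_trans (dF n); exact: avg_normc_le.
pose S t : \bar R := (\big[+%E/0]_(0 <= n <oo) (d n t)%:E)%E.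
have mS : measurable_fun D S.
  apply: (eq_measurable_fun (fun t => \big[+%E/0%E]_(0 <= i <oo | i \in xpredT) (d i t)%:E)).
    by move=> t _; apply: eq_eseriesl => i; rewrite unfold_in.
  have h0 k t : D t -> xpredT k -> (0 <= (d k t)%:E)%E by rewrite lee_fin.
  exact: (ge0_emeasurable_sum h0 (fun k _ => md k)).
have iS : mu.-integrable D S.
  apply/integrableP; split=> //.
  rewrite (_ : (\int[mu]_(x in D) `|S x|)%E = (\int[mu]_(x in D) S x)%E); last first.
    apply: eq_integral => t _; rewrite gee0_abs//.
    by apply: nneseries_ge0 => n _ _; rewrite lee_fin.
  rewrite integral_nneseries//; last by move=> n t _; rewrite lee_fin.
  apply: (@le_lt_trans _ _ (2 * (pi *+ 2))%:E); last by rewrite ltry.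
  apply: lime_le.
    by apply: is_cvg_nneseries => n _ _; apply: integral_ge0 => t _; rewrite lee_fin.
  apply: nearW => n.
  under eq_bigr do rewrite integral_avg//.
  rewrite sumEFin lee_fin -mulr_suml ler_wpM2r ?(ltW pi2_gt0)//.
  apply: (@le_trans _ _ (\sum_(0 <= i < n) 2^-1 ^+ i)); first exact: ler_sum.
  have := @geometric_le_lim R n 1 2^-1 ler01.
  rewrite invr_gt0 ltr0n gtr0_norm ?invr_gt0 ?ltr0n// => /(_ isT).
  rewrite (_ : 1 / (1 - 2^-1) = 2); last by field.
  rewrite invf_lt1 ?ltr0n// ltr1n => /(_ isT).
  by apply: le_trans; rewrite /series/=; under [leRHS]eq_bigr do rewrite mul1r.
have /aeS := @integrable_ae _ _ _ mu D measurable_D S iS; apply => t Dt St.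
have sd : cvgn (series (d ^~ t)).
  apply: nondecreasing_is_cvgn.
    by apply: nondecreasing_series => n _ _.
  exists (fine (S t)) => _ [n _ <-]; rewrite -lee_fin fineK//.
  rewrite /series/= -sumEFin.
  by apply: (@nneseries_lim_ge _ (fun n => (d n t)%:E) xpredT 0 n) => k _; rewrite lee_fin.
by split; apply: cvg_of_summable_diff sd => n;
  rewrite -?ReN -?ReD -?ImN -?ImD; [exact: normRe|exact: normIm].
Qed.

(** The limit is taken to be the limit superior, made real by [fine]: this is measurable on all of
    [Tdom], including the points where the sequence diverges. *)
Lemma cmeas_ae_lim (F : nat -> R -> C) : (forall n, cmeas (F n)) ->
  {ae mu, forall t, D t -> cvgn (fun n => Re (F n t)) /\ cvgn (fun n => Im (F n t))} ->
  exists2 f, cmeas f & {ae mu, forall t, D t ->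
    (Re (F n t) @[n --> \oo] --> Re (f t)) /\ (Im (F n t) @[n --> \oo] --> Im (f t))}.
Proof.
move=> mF cF; pose L (v : nat -> R) := fine (limn_esup (fun n => (v n)%:E)).
have LE (v : nat -> R) : cvgn v -> v n @[n --> \oo] --> L v.
  move=> cv; have /cvg_limn_einf_sup[_] : (v n)%:E @[n --> \oo] --> (limn v)%:E.
    by apply: cvg_EFin => //; apply: nearW.
  by rewrite /L => -> /=.
have mL (v : nat -> R -> R) : (forall n, measurable_fun D (v n)) ->
    measurable_fun D (fun t => L (v ^~ t)).
  move=> mv; apply: (@measurableT_comp _ _ _ _ _ _ fine).
    exact: fine_measurable.
  by apply: (measurable_fun_limn_esup (f := fun n t => (v n t)%:E)) => n;
    exact/measurable_EFinP.
exists (fun t => (L (fun n => Re (F n t)) +i* L (fun n => Im (F n t)))%C).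
  by split; apply: mL => n; case: (mF n).
by apply: (aeS cF) => t _ [c1 c2]; split; exact: LE.
Qed.

(** Riesz-Fischer: a subsequence G with geometrically small steps converges almost everywhere to
    some f, and Fatou's lemma applied to |F n - G k|^2 as k grows bounds the distance from F n to
    f. *)
Theorem L2_complete (F : nat -> R -> C) : (forall n, L2 (F n)) ->
  (forall e, 0 < e -> exists N, forall m n, (N <= m)%N -> (N <= n)%N ->
    nrm2 (fun t => F m t - F n t) <= e) ->
  exists2 f, L2 f & forall e, 0 < e -> exists N, forall n, (N <= n)%N ->
    nrm2 (fun t => F n t - f t) <= e.
Proof.
move=> F2 cauchyF.
have /choice[N hN] k : exists N, forall m n, (N <= m)%N -> (N <= n)%N ->
    nrm2 (fun t => F m t - F n t) <= ((2^-1 ^+ k) ^+ 2 : R).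
  by apply: cauchyF; rewrite !exprn_gt0.
(* The running maximum makes the indices nondecreasing while keeping [phi k] at least [N k]. *)
pose phi := fix phi k := if k is k'.+1 then maxn (phi k') (N k) else N 0%N.
have Nphi k : (N k <= phi k)%N by case: k => // k; exact: leq_maxr.
have phiS k : (phi k <= phi k.+1)%N by exact: leq_maxl.
have phi_homo : {homo phi : m n / (m <= n)%N} by apply: homo_leq => //; exact: leq_trans.
pose G k := F (phi k).
have G2 k : L2 (G k) by exact: F2.
have cG := ae_cvg_of_summable_diff G2.
have /cG {}cG k : nrm2 (fun t => G k.+1 t - G k t) <= (2^-1 ^+ k) ^+ 2.
  by apply: hN; [exact: leq_trans (phiS k)|exact: Nphi].
have mG k : cmeas (G k) by case: (G2 k).
have [f mf Gf] := cmeas_ae_lim mG cG.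
have key e : 0 < e -> exists N, forall n, (N <= n)%N ->
    L2 (fun t => F n t - f t) /\ nrm2 (fun t => F n t - f t) <= e.
  move=> /[dup] e0 /cauchyF[N1 hN1].
  have [K hK] : exists K, forall k, (K <= k)%N -> (N1 <= phi k)%N \/ (e : R) >= (2^-1 ^+ k) ^+ 2.
    have : (2^-1 : R) ^+ k @[k --> \oo] --> 0.
      by apply: cvg_expr; rewrite gtr0_norm ?invr_gt0 ?ltr0n// invf_lt1 ?ltr1n ?ltr0n.
    move/cvgrPdist_le => /(_ (Num.min e 1)).
    rewrite lt_min e0 ltr01 => /(_ isT)[K _ hK]; exists K => k /hK/=.
    rewrite sub0r normrN ger0_norm ?exprn_ge0// le_min => /andP[ke k1]; right.
    by apply: le_trans ke; rewrite expr2 ler_piMr// exprn_ge0.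
  exists (maxn N1 (N K)) => n; rewrite geq_max => /andP[Nn NKn].
  have dG k : nrm2 (fun t => F n t - G (k + K)%N t) <= e.
    have [h|h] := hK K (leqnn K).
      by apply: hN1 => //; apply: leq_trans h _; apply: phi_homo; exact: leq_addl.
    apply: le_trans h; apply: hN => //.
    by apply: leq_trans (Nphi K) _; apply: phi_homo; exact: leq_addl.
  pose g k t := (normc (F n t - G (k + K)%N t) ^+ 2)%:E.
  have B2 k : L2 (fun t => F n t - G (k + K)%N t) by exact: L2B.
  have mg k : measurable_fun D (g k).
    by apply/measurable_EFinP; apply: cmeas_normc2; case: (B2 k).
  have g0 k t : D t -> (0 <= g k t)%E by rewrite lee_fin sqr_ge0.
  have := fatou mu measurable_D mg g0.
  have mB : cmeas (fun t => F n t - f t) by apply: cmeasB => //; case: (F2 n).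
  rewrite (_ : (\int[mu]_(t in D) _)%E = (\int[mu]_(t in D) (normc (F n t - f t) ^+ 2)%:E)%E); last first.
    apply: ae_eq_integral => //.
    (* The limit inferior is measurable because it is minus the limit superior of the negated
       functions. *)
    - have lE : (fun t => limn_einf (g ^~ t)) =
          (fun t => - limn_esup (fun k => - g k t))%E.
        by apply/funext => t; rewrite -limn_einfN; congr limn_einf;
          apply/funext => k; exact: (esym (oppeK (g k t))).
      change (measurable_fun D (fun t => limn_einf (g ^~ t))); rewrite lE.
      apply: (@measurableT_comp _ _ _ _ _ _ -%E); first exact: oppe_measurable.
      apply: (measurable_fun_limn_esup (f := fun k t => - g k t)%E) => k.
      by apply: (@measurableT_comp _ _ _ _ _ _ -%E); first exact: oppe_measurable.
    - by apply/measurable_EFinP; exact: cmeas_normc2.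
    apply: (aeS Gf) => t Dt [hR hI].
    suff /cvg_limn_einf_sup[-> _//] : g k t @[k --> \oo] --> (normc (F n t - f t) ^+ 2)%:E.
    apply: cvg_EFin; first exact: nearW.
    rewrite /g/=; under eq_fun do rewrite /= sqr_normc !ReImE.
    rewrite sqr_normc !ReImE.
    by apply: cvgD; rewrite !expr2; apply: cvgM; apply: cvgB => //; (try exact: cvg_cst);
      rewrite (cvg_shiftn K (fun k => _ (G k t))).
  move=> /le_trans => /(_ (e * (pi *+ 2))%:E) h.
  have {h} le_e : (\int[mu]_(t in D) (normc (F n t - f t) ^+ 2)%:E <= (e * (pi *+ 2))%:E)%E.
    apply: h; apply: limn_einf_le => k; rewrite integral_avg; last by case: (B2 k).
    by rewrite lee_fin ler_wpM2r ?(ltW pi2_gt0)// dG.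
  have L : L2 (fun t => F n t - f t).
    split=> //; apply/integrableP; split; first by apply/measurable_EFinP; exact: cmeas_normc2.
    rewrite (_ : (\int[mu]_(x in D) _)%E = (\int[mu]_(t in D) (normc (F n t - f t) ^+ 2)%:E)%E).
      by apply: le_lt_trans le_e _; rewrite ltry.
    by apply: eq_integral => t _; rewrite gee0_abs// lee_fin sqr_ge0.
  split=> //; move: le_e; rewrite integral_avg; last by case: L.
  by rewrite lee_fin ler_pM2r// pi2_gt0.
exists f; last by move=> e /key[n hn]; exists n => k /hn[].
have [n /(_ n (leqnn n))[h _]] := key 1 ltr01.
have := L2B (F2 n) h; by under eq_fun do rewrite opprB addrC subrK.
Unshelve. all: by end_near.
Qed.

End Completeness.

(** * Uniqueness of Fourier coefficients *)

Section Steep.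
Context {R : realType}.
Implicit Types (a y : R) (k N : nat).

(* The functions of Brosowski and Deutsch: on [0, 1] they converge boundedly to the
   indicator of ]1/2, 1], so polynomials in [arc] below approximate indicators of arcs. *)
Definition steep k y : R := 1 - (1 - y ^+ k) ^+ (2 ^ k).

Lemma bernoulli_le a N : 0 <= a <= 1 -> 1 - N%:R * a <= (1 - a) ^+ N.
Proof.
move=> /andP[a0 a1]; elim: N => [|N ih]; first by rewrite mul0r subr0 expr0.
rewrite exprS -natr1; apply: (@le_trans _ _ ((1 - a) * (1 - N%:R * a))).
  have N0 : 0 <= N%:R * a ^+ 2 by rewrite mulr_ge0 ?sqr_ge0.
  rewrite -subr_ge0; apply: le_trans N0 _.
  by rewrite le_eqVlt; apply/orP; left; apply/eqP; ring.
by rewrite ler_wpM2l// subr_ge0.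
Qed.

Lemma bernoulli_ge a N : 0 <= a <= 1 -> (1 - a) ^+ N * (1 + N%:R * a) <= 1.
Proof.
move=> /andP[a0 a1]; elim: N => [|N ih]; first by rewrite mul0r addr0 expr0 mulr1.
apply: le_trans ih; rewrite exprSr -mulrA ler_wpM2l ?exprn_ge0 ?subr_ge0//.
have N0 : 0 <= N.+1%:R * a ^+ 2 by rewrite mulr_ge0 ?sqr_ge0.
rewrite -subr_ge0; apply: le_trans N0 _.
by rewrite -natr1 le_eqVlt; apply/orP; left; apply/eqP; ring.
Qed.

Lemma steep_itv k y : 0 <= y <= 1 -> 0 <= steep k y <= 1.
Proof.
move=> /andP[y0 y1]; have p0 : 0 <= y ^+ k by rewrite exprn_ge0.
have p1 : y ^+ k <= 1 by rewrite exprn_ile1.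
have q0 : 0 <= (1 - y ^+ k) ^+ (2 ^ k) by rewrite exprn_ge0// subr_ge0.
have q1 : (1 - y ^+ k) ^+ (2 ^ k) <= 1.
  by rewrite exprn_ile1 ?subr_ge0// gerBl.
by rewrite /steep; apply/andP; split; lra.
Qed.

(** Bernoulli's inequality with a = y^k and N = 2^k gives [steep k y] <= N a = (2 y)^k. *)
Lemma steep_cvg0 y : 0 <= y < 1 / 2 -> steep k y @[k --> \oo] --> (0 : R).
Proof.
move=> /andP[y0 y1]; have y2 : 0 <= y <= 1 by rewrite y0 /=; lra.
have c2 : (2 * y) ^+ k @[k --> \oo] --> (0 : R).
  by apply: cvg_expr; rewrite ger0_norm; lra.
apply: (squeeze_cvgr _ (cvg_cst (0 : R)) c2).
apply: nearW => k; have /andP[-> _] := steep_itv k y2.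
rewrite /steep; have := @bernoulli_le (y ^+ k) (2 ^ k).
rewrite exprn_ge0//= exprn_ile1 //; last by case/andP: y2.
by move=> /(_ isT); rewrite natrX -exprMn; lra.
Qed.

(** The companion bound (1 - a)^N <= 1 / (1 + N a), again with N a = (2 y)^k, gives 1 - [steep k y]
    <= (2 y)^(-k). *)
Lemma steep_cvg1 y : 1 / 2 < y <= 1 -> steep k y @[k --> \oo] --> (1 : R).
Proof.
move=> /andP[y0 y1]; have y2 : 0 <= y <= 1 by rewrite y1 andbT; lra.
have c2 : 1 - (2 * y)^-1 ^+ k @[k --> \oo] --> (1 : R).
  rewrite -[X in _ --> X]subr0; apply: cvgB; first exact: cvg_cst.
  apply: cvg_expr; rewrite ger0_norm ?invr_ge0; last lra.
  by rewrite invf_lt1; lra.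
apply: (squeeze_cvgr _ c2 (cvg_cst (1 : R))).
apply: nearW => k; have /andP[_ ->] := steep_itv k y2.
rewrite andbT /steep lerD2l lerN2; have := @bernoulli_ge (y ^+ k) (2 ^ k).
rewrite exprn_ge0//= ?exprn_ile1//; try by (case/andP: y2); last by lra.
move=> /(_ isT); rewrite natrX -exprMn; set q := (1 - _) ^+ _.
have q0 : 0 <= q by rewrite exprn_ge0// subr_ge0 exprn_ile1//; case/andP: y2.
have z0 : 0 < (2 * y) ^+ k by rewrite exprn_gt0//; lra.
rewrite exprVn mulrDr mulr1 => h.
by rewrite -[_^-1]mul1r ler_pdivlMr//; lra.
Qed.

End Steep.

Section FourierUniqueness.
Context {R : realType}.
Local Notation C := R[i].
Local Notation normc := (@Normc.normc R).
Local Notation mu := (@lebesgue_measure R).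
Local Notation D := (@Tdom R).
Local Notation Re := (@complex.Re R).
Local Notation Im := (@complex.Im R).
Local Notation rint g := (mu.-integrable D (EFin \o g)).
Implicit Types (f g : R -> C) (u v : R -> R) (c : C) (M : R).

#[local] Hint Extern 0 (measurable (@Tdom _)) => exact: measurable_D : core.

Definition no_fourier f := L1 f /\ forall n : int, mean (fun t => f t * eT t ^ n) = 0.

(** Stands in for the trigonometric polynomials: stability under sums and products is immediate here
    and needs no bookkeeping of coefficients. *)
Definition fourier_mult f := forall g, no_fourier g -> no_fourier (fun t => g t * f t).

Lemma fourier_mult_cst c : fourier_mult (fun=> c).
Proof.
move=> g [g1 hg]; split.
  by under eq_fun do rewrite mulrC; exact: L1Z.
move=> n; transitivity (c * mean (fun t => g t * eT t ^ n)); last by rewrite hg mulr0.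
rewrite -meanZ; first by apply: eq_mean => t _; rewrite -mulrA mulrCA.
apply: (@L1M_bounded _ _ _ 1) => //.
  case: n => n; first by apply: cmeasX; exact: cmeas_eT.
  by under eq_fun do rewrite NegzE -exprnN; apply: cmeasV; apply: cmeasX; exact: cmeas_eT.
move=> t _; case: n => n; first by rewrite -exprnP normcX normc_eT expr1n.
by rewrite NegzE -exprnN Normc.normcV normcX normc_eT expr1n invr1.
Qed.

Lemma L1_eTz f (n : int) : L1 f -> L1 (fun t => f t * eT t ^ n).
Proof.
move=> f1; apply: (@L1M_bounded _ _ _ 1) => //.
  case: n => n; first by apply: cmeasX; exact: cmeas_eT.
  by under eq_fun do rewrite NegzE -exprnN; apply: cmeasV; apply: cmeasX; exact: cmeas_eT.
move=> t _; case: n => n; first by rewrite -exprnP normcX normc_eT expr1n.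
by rewrite NegzE -exprnN Normc.normcV normcX normc_eT expr1n invr1.
Qed.

Lemma fourier_mult_eT (m : int) : fourier_mult (fun t => eT t ^ m).
Proof.
move=> g [g1 hg]; split; first exact: L1_eTz.
move=> n; rewrite -(hg (m + n)); apply: eq_mean => t _.
by rewrite expfzDr ?eT_neq0// mulrA.
Qed.

Lemma fourier_multD f g : fourier_mult f -> fourier_mult g ->
  fourier_mult (fun t => f t + g t).
Proof.
move=> mf mg h nh; have [f1 hf] := mf _ nh; have [g1 hg] := mg _ nh.
split; first by under eq_fun do rewrite mulrDr; exact: L1D.
move=> n; under [X in mean X]eq_fun do rewrite mulrDr mulrDl.
by rewrite meanD ?hf ?hg ?addr0//; exact: L1_eTz.
Qed.

Lemma fourier_multM f g : fourier_mult f -> fourier_mult g ->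
  fourier_mult (fun t => f t * g t).
Proof.
by move=> mf mg h nh; under eq_fun do rewrite mulrA; exact/mg/mf.
Qed.

Lemma fourier_multX f n : fourier_mult f -> fourier_mult (fun t => f t ^+ n).
Proof.
move=> mf; elim: n => [|n ih].
  by under eq_fun do rewrite expr0; exact: fourier_mult_cst.
by under eq_fun do rewrite exprS; exact: fourier_multM.
Qed.

Lemma fourier_mult_1B f : fourier_mult f -> fourier_mult (fun t => 1 - f t).
Proof.
move=> mf; under eq_fun do rewrite -mulN1r.
by apply: fourier_multD; [|apply: fourier_multM => //]; exact: fourier_mult_cst.
Qed.

(* A trigonometric polynomial with values in [0, 1] on [0, 2 pi], exceeding 1/2 exactly
   on the arc ]0, x[: the difference to 1/2 is
   (cos (t - x / 2) - cos (x / 2)) / 4 = sin (t / 2) sin ((x - t) / 2) / 2. *)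
Definition arc (x t : R) : R := 1 / 2 + (cos (t - x / 2) - cos (x / 2)) / 4.

Lemma arc_itv x t : 0 <= arc x t <= 1.
Proof.
have := cos_le1 (t - x / 2); have := cos_geN1 (t - x / 2).
have := cos_le1 (x / 2); have := cos_geN1 (x / 2).
by rewrite /arc; move=> *; apply/andP; split; lra.
Qed.

Lemma arcE x t : arc x t = 1 / 2 + sin (t / 2) * sin ((x - t) / 2) / 2.
Proof.
rewrite /arc; congr (_ + _).
rewrite [in cos (x / 2)](_ : x / 2 = t / 2 + (x - t) / 2); last by field.
rewrite (_ : t - x / 2 = t / 2 - (x - t) / 2); last by field.
by rewrite cosB cosD; field.
Qed.

Lemma arc_gt x t : x < pi *+ 2 -> 0 < t < x -> 1 / 2 < arc x t.
Proof.
move=> x2 /andP[t0 tx]; have p := @pi_gt0 R; rewrite arcE ltrDl divr_gt0// mulr_gt0//.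
  by apply: sin_gt0_pi; rewrite divr_gt0//= ltr_pdivrMr//; lra.
by apply: sin_gt0_pi; rewrite divr_gt0//= ?ltr_pdivrMr//; lra.
Qed.

Lemma arc_lt x t : 0 < x -> x < t < pi *+ 2 -> arc x t < 1 / 2.
Proof.
move=> x0 /andP[xt t2]; have p := @pi_gt0 R; rewrite arcE gtrDl pmulr_llt0//.
rewrite (_ : (x - t) / 2 = - ((t - x) / 2)); last by field.
rewrite sinN mulrN oppr_lt0 mulr_gt0//.
  by apply: sin_gt0_pi; rewrite divr_gt0//= ?ltr_pdivrMr//; lra.
by apply: sin_gt0_pi; rewrite divr_gt0//= ?ltr_pdivrMr//; lra.
Qed.

Lemma fourier_mult_arc x : fourier_mult (fun t => ((arc x t)%:C)%C).
Proof.
pose a := (cos (x / 2) / 8 -i* (sin (x / 2) / 8))%C.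
rewrite (_ : (fun t => _) = fun t => (1 / 2 - cos (x / 2) / 4)%:C%C +
    (a * eT t ^ 1%Z + (a^*)%C * eT t ^ (-1)%Z)).
  apply: fourier_multD; first exact: fourier_mult_cst.
  by apply: fourier_multD; apply: fourier_multM; (exact: fourier_mult_cst || exact: fourier_mult_eT).
apply/funext => t; rewrite expr1z exprN1 -eT_conj /arc cosB.
by apply: eqc; rewrite /a /eT !ReImE/=; field.
Qed.

Lemma fourier_mult_steep x k : fourier_mult (fun t => ((steep k (arc x t))%:C)%C).
Proof.
rewrite (_ : (fun t => _) = fun t => 1 - (1 - ((arc x t)%:C)%C ^+ k) ^+ (2 ^ k)).
  by apply: fourier_mult_1B; apply: fourier_multX; apply: fourier_mult_1B;
    apply: fourier_multX; exact: fourier_mult_arc.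
by apply/funext => t; rewrite /steep rmorphB rmorph1 rmorphXn rmorphB rmorph1 rmorphXn.
Qed.

Lemma measurable_arc x : measurable_fun D (arc x).
Proof.
apply: measurable_funTS; apply: continuous_measurable_fun => t.
apply: cvgD; first exact: cvg_cst.
apply: cvgM; last exact: cvg_cst.
apply: cvgB; last exact: cvg_cst.
apply: (@continuous_comp _ _ _ (fun t => t - x / 2) (@cos R)).
  by apply: cvgB; [exact: cvg_id|exact: cvg_cst].
exact: continuous_cos.
Qed.

Lemma measurable_steep x k : measurable_fun D (fun t => steep k (arc x t)).
Proof.
apply: measurable_funB; first exact: measurable_cst.
apply: measurable_funX; apply: measurable_funB; first exact: measurable_cst.
by apply: measurable_funX; exact: measurable_arc.
Qed.

Lemma ae_neq (a : R) : {ae mu, forall t : R, t != a}.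
Proof.
exists [set a]; split => //; first exact: lebesgue_measure_set1.
by move=> t /= /negP; rewrite negbK => /eqP.
Qed.

(** Dominated convergence: on [Tdom] the functions [steep k (arc x t)] are bounded by 1 and tend
    almost everywhere to the indicator of the arc from 0 to x. *)
Lemma Rintegral_arc0 u x : rint u ->
  (forall k, avg (fun t => u t * steep k (arc x t)) = 0) ->
  0 < x < pi *+ 2 -> Rintegral mu D (u \_ `]-oo, x]) = 0.
Proof.
move=> iu hu /andP[x0 x2].
have mu_ := rint_meas iu.
pose F k t := (u t * steep k (arc x t))%:E.
have mF k : measurable_fun D (F k).
  by apply/measurable_EFinP; apply: measurable_funM => //; exact: measurable_steep.
have mg : measurable_fun D (EFin \o (u \_ `]-oo, x])).
  apply/measurable_EFinP; apply/measurable_restrict => //.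
  by apply: measurable_funS mu_ => // t [].
have aF k t : (`|F k t| <= `|u t|%:E)%E.
  rewrite lee_fin normrM ler_piMr// ger0_norm; by have /andP[] := steep_itv k (arc_itv x t).
have cF : {ae mu, forall t, D t -> F ^~ t @ \oo --> (EFin \o (u \_ `]-oo, x])) t}.
  have Fl := @ae_filter_ringOfSetsType _ _ _ mu.
  (* At 0 and at x the value of [arc] is exactly 1/2, where [steep] tends to neither 0 nor 1. *)
  apply: filterS2 (ae_neq 0) (ae_neq x) => t tn0 tnx.
  rewrite /Tdom/= in_itv/= => /andP[t0 t2].
  apply: cvg_EFin; first exact: nearW.
  have t0' : 0 < t by rewrite lt_def tn0.
  rewrite /F/= patchE; case: ifPn.
    rewrite inE/= in_itv/= => tx.
    rewrite -[X in _ --> X]mulr1; apply: cvgM; first exact: cvg_cst.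
    apply: steep_cvg1; have /andP[_ ->] := arc_itv x t; rewrite andbT.
    by apply: arc_gt => //; rewrite t0' lt_neqAle tnx.
  rewrite notin_setE/= in_itv/= => /negP; rewrite -ltNge => tx.
  rewrite -[X in _ --> X](mulr0 (u t)); apply: cvgM; first exact: cvg_cst.
  apply: steep_cvg0; have /andP[-> _] := arc_itv x t; rewrite /=.
  by apply: arc_lt => //; rewrite tx.
have aF' : {ae mu, forall t n, D t -> (`|F n t| <= (`|u t|%R)%:E)%E}.
  by apply: aeW => t n _; exact: aF.
have [_ _] := @dominated_convergence _ _ _ mu D measurable_D F _ _ mF mg cF (rint_norm iu) aF'.
have int0 k : (\int[mu]_(t in D) F k t = 0)%E.
  rewrite integral_avg ?hu ?mul0r//.
  apply: (rint_dom _ (rint_norm iu)).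
    by apply: measurable_funM => //; exact: measurable_steep.
  by move=> t _; have := aF k t; rewrite lee_fin.
under eq_fun do rewrite int0.
move=> /cvg_unique => /(_ (@ereal_hausdorff R) _ (cvg_cst _)) h.
exact: (congr1 fine h).
Qed.

(** Lebesgue differentiation: almost everywhere u is the derivative of its primitive, which is
    locally constant inside the interval. Extending u by 0 outside [Tdom] turns the integrals into a
    primitive starting at -oo, the form that [FTC1Ny] expects. *)
Lemma ae_eq0_of_primitive u : rint u ->
  (forall x, 0 < x < pi *+ 2 -> Rintegral mu D (u \_ `]-oo, x]) = 0) ->
  {ae mu, forall t, D t -> u t = 0}.
Proof.
move=> iu hu; have loc := integrable_locally measurable_D iu.
have iT : mu.-integrable setT (EFin \o (u \_ D)).
  by rewrite -restrict_EFin; exact: (@integrable_mkcond _ _ _ mu D (EFin \o u) measurable_D).1.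
have iy y : mu.-integrable `]-oo, y] (EFin \o (u \_ D)).
  exact: integrableS iT.
have := FTC1Ny iy loc; set F := (fun x => Rintegral _ _ _).
have F0 x : 0 < x < pi *+ 2 -> F x = 0.
  by move=> hx; rewrite /F -Rintegral_mkcondr Rintegral_mkcondl hu.
have Fl := @ae_filter_ringOfSetsType _ _ _ mu.
move=> h; apply: filterS2 (ae_neq 0) h => t t0 [_ h] /[dup] Dt.
rewrite /Tdom/= in_itv/= => /andP[tge t2].
have tgt : 0 < t by rewrite lt_def t0.
move: h; rewrite patchE mem_set// => <-.
rewrite -(derive1_cst (0 : R^o) t) !derive1E; apply: near_eq_derive.
near=> s; apply: F0; apply/andP; split; near: s.
- exact: lt_nbhsr.
- exact: lt_nbhsl.
Unshelve. all: by end_near.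
Qed.

(** Only the coefficient of index 0 of f times a multiplier is used. As [steep k (arc x t)] is real,
    its vanishing separates into statements on the real and the imaginary part of f. *)
Theorem fourier_unique f : no_fourier f -> {ae mu, forall t, D t -> f t = 0}.
Proof.
move=> nf; have [[f1 f2] _] := nf.
have key k x : mean (fun t => f t * ((steep k (arc x t))%:C)%C) = 0.
  have [_ /(_ 0)] := @fourier_mult_steep x k _ nf.
  by move=> h; rewrite -[RHS]h; apply: eq_mean => t _; rewrite expr0z mulr1.
have r0 : {ae mu, forall t, D t -> Re (f t) = 0}.
  apply: (ae_eq0_of_primitive f1) => x; apply: (Rintegral_arc0 f1) => k.
  have /(congr1 Re)/= h := key k x; rewrite -[RHS]h.
  by apply: eq_avg => t _; rewrite ReM/= mulr0 subr0.
have i0 : {ae mu, forall t, D t -> Im (f t) = 0}.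
  apply: (ae_eq0_of_primitive f2) => x; apply: (Rintegral_arc0 f2) => k.
  have /(congr1 Im)/= h := key k x; rewrite -[RHS]h.
  by apply: eq_avg => t _; rewrite ImM/= mulr0 add0r.
by apply: (aeS (aeI r0 i0)) => t _ [hr hi]; exact: eqc.
Qed.

End FourierUniqueness.

(** * The Hardy space of the disc *)

Section Hardy.
Context {R : realType}.
Local Notation C := R[i].
Local Notation normc := (@Normc.normc R).
Local Notation mu := (@lebesgue_measure R).
Local Notation D := (@Tdom R).
Local Notation Re := (@complex.Re R).
Local Notation Im := (@complex.Im R).
Local Notation rint g := (mu.-integrable D (EFin \o g)).
Implicit Types (f g : R -> C) (u v : R -> R) (c z : C) (M x q : R).

Lemma le_geometric_eq0 x q M : 0 <= x -> 0 <= q < 1 ->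
  (forall n, x <= q ^+ n * M) -> x = 0.
Proof.
move=> x0 /andP[q0 q1] xq; apply/eqP; rewrite eq_le x0 andbT.
have qM : q ^+ n * M @[n --> \oo] --> (0 : R).
  rewrite -[X in _ --> X](mul0r M); apply: cvgM; last exact: cvg_cst.
  by apply: cvg_expr; rewrite ger0_norm.
apply: (@ler_cvg_to _ _ _ _ (fun=> x) _ _ _ (cvg_cst x) qM).
exact: nearW.
Qed.

(** Multiplying f by the conjugate of its mean makes the mean real, and then the real part of the
    integrand is at most its modulus. *)
Lemma normc_mean_avg f : L1 f -> normc (mean f) <= avg (fun t => normc (f t)).
Proof.
move=> f1; have [->|m0] := eqVneq (mean f) 0.
  by rewrite Normc.normc0 avg_ge0// => t _; exact: normc_ge0.
have n0 : 0 < normc (mean f) by rewrite normc_gt0.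
rewrite -(ler_pM2l n0) -avgZ; last exact: rint_normc.
have -> : normc (mean f) * normc (mean f) = Re (mean (fun t => ((mean f)^*)%C * f t)).
  by rewrite meanZ// [X in Re X]mulrC mulcJ /= expr2.
rewrite -[Re (mean _)]/(avg (fun t => Re (((mean f)^*)%C * f t))); apply: le_avg.
- by have [] := L1Z ((mean f)^*)%C f1.
- exact/rintZ/rint_normc.
- move=> t _; apply: le_trans (ler_norm _) _; apply: le_trans (normRe _) _.
  by rewrite Normc.normcM normcJ.
Qed.

Lemma cmeas_eTX n : cmeas (fun t => @eT R t ^+ n).
Proof. by apply: cmeasX; exact: cmeas_eT. Qed.

Lemma normc_eTX (t : R) n : normc (eT t ^+ n) = 1.
Proof. by rewrite normcX normc_eT expr1n. Qed.

Lemma cmeas_eTVX n : cmeas (fun t => (@eT R t)^-1 ^+ n).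
Proof. by apply: cmeasX; apply: cmeasV; exact: cmeas_eT. Qed.

Lemma normc_eTVX (t : R) n : normc ((eT t)^-1 ^+ n) = 1.
Proof. by rewrite normcX Normc.normcV normc_eT invr1 expr1n. Qed.

Lemma L2_eTX f n : L2 f -> L2 (fun t => f t * eT t ^+ n).
Proof.
by apply: (@L2M_bounded _ _ _ 1); [exact: cmeas_eTX|move=> t _; rewrite normc_eTX].
Qed.

Lemma L2_eTVX f n : L2 f -> L2 (fun t => f t * (eT t)^-1 ^+ n).
Proof.
by apply: (@L2M_bounded _ _ _ 1); [exact: cmeas_eTVX|move=> t _; rewrite normc_eTVX].
Qed.

Lemma normc_mean_bounded f g M : cmeas g -> (forall t, D t -> normc (g t) <= M) ->
  L2 f -> normc (mean (fun t => f t * g t)) ^+ 2 <= M ^+ 2 * nrm2 f.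
Proof.
move=> mg gM f2; apply: le_trans (normc_mean_le _) _; first exact: (L2M_bounded mg gM).
exact: nrm2M_bounded.
Qed.

(** H^2(D) in terms of the angle: the mean of f e^(i(n+1)t) is the Fourier coefficient of index
    -(n+1). [H2DP] is the link with [H2D]. *)
Definition hardy f := L2 f /\ forall n, mean (fun t => f t * eT t ^+ n.+1) = 0.

Lemma hardy_L2 f : hardy f -> L2 f. Proof. by case. Qed.

Lemma hardyD f g : hardy f -> hardy g -> hardy (fun t => f t + g t).
Proof.
move=> [f2 hf] [g2 hg]; split; first exact: L2D.
move=> n; under [X in mean X]eq_fun do rewrite mulrDl.
by rewrite meanD ?hf ?hg ?addr0//; exact/L2_L1/L2_eTX.
Qed.

Lemma hardyZ c f : hardy f -> hardy (fun t => c * f t).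
Proof.
move=> [f2 hf]; split; first exact: L2Z.
move=> n; under [X in mean X]eq_fun do rewrite -mulrA.
by rewrite meanZ ?hf ?mulr0//; exact/L2_L1/L2_eTX.
Qed.

Lemma hardyN f : hardy f -> hardy (fun t => - f t).
Proof. by move=> hf; under eq_fun do rewrite -mulN1r; exact: hardyZ. Qed.

Lemma hardyB f g : hardy f -> hardy g -> hardy (fun t => f t - g t).
Proof. by move=> hf hg; apply: hardyD => //; exact: hardyN. Qed.

Lemma hardy_eT f : hardy f -> hardy (fun t => f t * eT t) /\ mean (fun t => f t * eT t) = 0.
Proof.
move=> [f2 hf]; split; last by have := hf 0%N; under [X in mean X]eq_fun do rewrite expr1.
split; first by have := L2_eTX 1 f2; under eq_fun do rewrite expr1.
by move=> n; have := hf n.+1; under [X in mean X]eq_fun do rewrite exprS mulrA.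
Qed.

Lemma hardy_eTX f n : hardy f -> hardy (fun t => f t * eT t ^+ n).
Proof.
move=> hf; elim: n => [|n ih]; first by under eq_fun do rewrite expr0 mulr1.
by have [h _] := hardy_eT ih; move: h; under eq_fun do rewrite -mulrA -exprSr.
Qed.

Lemma normc_resolvent z (w : C) : normc z < 1 -> normc w = 1 ->
  1 - z * w != 0 /\ normc (1 - z * w)^-1 <= (1 - normc z)^-1.
Proof.
move=> z1 w1; have h : 1 - normc z <= normc (1 - z * w).
  have := le_normcD (1 - z * w) (z * w); rewrite subrK Normc.normc1 Normc.normcM w1 mulr1.
  lra.
have p : 0 < 1 - normc z by lra.
have p' : 0 < normc (1 - z * w) by lra.
by rewrite -normc_gt0 p' Normc.normcV lef_pV2.
Qed.

Lemma cmeas_resolvent z f : cmeas f -> cmeas (fun t => (1 - z * f t)^-1).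
Proof.
move=> mf; apply: cmeasV; apply: cmeasB; first exact: cmeas_cst.
by apply: cmeasM => //; exact: cmeas_cst.
Qed.

Lemma Rintegral_periodic_derivative (F f : R -> R) :
  (forall x, is_derive x 1 F (f x)) -> continuous f -> F 0 = F (pi *+ 2) ->
  Rintegral mu D f = 0.
Proof.
move=> dF cf F02; have p := @pi2_gt0 R.
have cwf : {within `[0, pi *+ 2], continuous f} by apply: continuous_subspaceT.
have cF : continuous F.
  by move=> x; apply: differentiable_continuous; apply/derivable1_diffP; apply: ex_derive.
have i : mu.-integrable `[0, pi *+ 2] (EFin \o f).
  by apply: continuous_compact_integrable => //; exact: segment_compact.
have dLR : derivable_oo_LRcontinuous F 0 (pi *+ 2).
  split; first by move=> x _; apply: ex_derive.
  - by apply: cvg_at_right_filter; exact: cF.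
  - by apply: cvg_at_left_filter; exact: cF.
have F' : {in `]0, pi *+ 2[, F^`()%classic =1 f}.
  by move=> x _; rewrite derive1E; exact: derive_val.
rewrite /Tdom Rintegral_itv_bndo_bndc; last first.
  by apply: integrableS i => //; apply: subset_itvl; rewrite bnd_simp.
by rewrite /Rintegral (continuous_FTC2 p cwf dLR F') F02 subee.
Qed.

Lemma mean_eTX n : mean (fun t => @eT R t ^+ n.+1) = 0.
Proof.
have n0 : n.+1%:R != 0 :> R by rewrite pnatr_eq0.
have ck : continuous (fun t : R => n.+1%:R * t).
  by move=> x; apply: cvgM; [exact: cvg_cst|exact: cvg_id].
have e2pi : eT (n.+1%:R * pi *+ 2) = 1 :> C.
  by rewrite -mulrnAr eT_mulrn /eT cos2pi sin2pi expr1n.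
have ReE (t : R) : Re (eT t ^+ n.+1) = cos (n.+1%:R * t) by rewrite -eT_mulrn.
have ImE (t : R) : Im (eT t ^+ n.+1) = sin (n.+1%:R * t) by rewrite -eT_mulrn.
have dS (x : R) : is_derive x 1 (fun t => n.+1%:R^-1 * sin (n.+1%:R * t)) (cos (n.+1%:R * x)).
  by apply: is_derive_eq; rewrite /GRing.scale/=; field.
have dC (x : R) : is_derive x 1 (fun t => - n.+1%:R^-1 * cos (n.+1%:R * t)) (sin (n.+1%:R * x)).
  by apply: is_derive_eq; rewrite /GRing.scale/=; field.
apply: eqc; rewrite /mean/= /avg.
  under [X in Rintegral _ _ X]eq_fun do rewrite ReE.
  rewrite (Rintegral_periodic_derivative dS) ?mul0r//.
  - by move=> x; apply: continuous_comp; [exact: ck|exact: continuous_cos].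
  - by rewrite mulr0 sin0 mulr0 mulrnAr; have [_ ->] := e2pi; rewrite mulr0.
under [X in Rintegral _ _ X]eq_fun do rewrite ImE.
rewrite (Rintegral_periodic_derivative dC) ?mul0r//.
- by move=> x; apply: continuous_comp; [exact: ck|exact: continuous_sin].
- by rewrite mulr0 cos0 mulrnAr; have [-> _] := e2pi.
Qed.

Lemma hardy_cst c : hardy (fun=> c).
Proof.
split; first exact: L2_cst.
move=> n; have L : L1 (fun t => @eT R t ^+ n.+1).
  by have := L2_L1 (L2_eTX n.+1 (L2_cst 1)); under eq_fun do rewrite mul1r.
rewrite meanZ//; suff -> : mean (fun t => @eT R t ^+ n.+1) = 0 by rewrite mulr0.
exact: mean_eTX.
Qed.

(* The moments c_n of g = f / (1 - z e) against e^n satisfy c_n = z c_(n+1) for n > 0 and are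
   bounded, hence vanish; the case n = 0 gives the mean value. *)
Lemma hardy_resolvent f z : normc z < 1 -> hardy f ->
  hardy (fun t => f t * (1 - z * eT t)^-1) /\
  mean (fun t => f t * (1 - z * eT t)^-1) = mean f.
Proof.
move=> z1 [f2 hf]; set g := fun t => _.
have g2 : L2 g.
  apply: (@L2M_bounded _ _ _ (1 - normc z)^-1) => //.
    by apply: cmeas_resolvent; exact: cmeas_eT.
  by move=> t _; have [] := normc_resolvent z1 (normc_eT t).
have rec n : mean (fun t => g t * eT t ^+ n) =
    mean (fun t => f t * eT t ^+ n) + z * mean (fun t => g t * eT t ^+ n.+1).
  rewrite -meanZ; last exact/L2_L1/L2_eTX.
  rewrite -meanD; [|exact/L2_L1/L2_eTX|exact/L1Z/L2_L1/L2_eTX].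
  apply: eq_mean => t _; rewrite /g exprS.
  by field; have [] := normc_resolvent z1 (normc_eT t).
have rec' j n : mean (fun t => g t * eT t ^+ n.+1) =
    z ^+ j * mean (fun t => g t * eT t ^+ (n + j).+1).
  elim: j => [|j ih]; first by rewrite expr0 mul1r addn0.
  by rewrite ih rec hf add0r mulrA -exprSr addnS.
have g0 n : mean (fun t => g t * eT t ^+ n.+1) = 0.
  apply/eqP; rewrite -normc_eq0 -sqrf_eq0; apply/eqP.
  apply: (@le_geometric_eq0 _ (normc z ^+ 2) (nrm2 g)); first exact: sqr_ge0.
    by rewrite sqr_ge0 expr_lt1// normc_ge0.
  move=> j; rewrite (rec' j) Normc.normcM exprMn normcX exprAC.
  rewrite ler_wpM2l ?exprn_ge0 ?normc_ge0//.
  have := @normc_mean_bounded g _ 1 (cmeas_eTX (n + j).+1) _ g2.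
  by rewrite expr1n mul1r; apply => t _; rewrite normc_eTX.
split; first by split.
have := rec 0%N; under [X in mean X]eq_fun do rewrite expr0 mulr1.
under [X in mean X + _]eq_fun do rewrite expr0 mulr1.
by rewrite g0 mulr0 addr0.
Qed.

Definition ckernel z (t : R) : C := (1 - z * (eT t)^-1)^-1.

(** The Cauchy integral: expanding the kernel as a geometric series shows it to be the power series
    with the Fourier coefficients of index n >= 0, that is, the extension of f to D. *)
Definition cauchy f z : C := mean (fun t => f t * ckernel z t).

Lemma cmeas_ckernel z : cmeas (ckernel z).
Proof. by apply: cmeas_resolvent; apply: cmeasV; exact: cmeas_eT. Qed.

Lemma normc_eTV (t : R) : normc (eT t)^-1 = 1.
Proof. by rewrite Normc.normcV normc_eT invr1. Qed.

Lemma ckernel_unit z (t : R) : normc z < 1 -> 1 - z * (eT t)^-1 != 0.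
Proof. by move=> z1; have [] := normc_resolvent z1 (normc_eTV t). Qed.

Lemma ckernel_unit' z (t : R) : normc z < 1 -> eT t - z != 0.
Proof.
move=> /(ckernel_unit t); apply: contra => /eqP/subr0_eq <-.
by rewrite mulfV ?eT_neq0// subrr.
Qed.

Lemma normc_ckernel z (t : R) : normc z < 1 -> normc (ckernel z t) <= (1 - normc z)^-1.
Proof. by move=> z1; have [] := normc_resolvent z1 (normc_eTV t). Qed.

Lemma ckernelJ z (t : R) : ((ckernel z t)^*)%C = (1 - (z^*)%C * eT t)^-1.
Proof.
by rewrite /ckernel conjc_inv conjcB conjc1 conjcM -eT_conj conjcK.
Qed.

Lemma L2_ckernel f z : normc z < 1 -> L2 f -> L2 (fun t => f t * ckernel z t).
Proof.
move=> z1; apply: L2M_bounded; first exact: cmeas_ckernel.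
by move=> t _; exact: normc_ckernel.
Qed.

(** The conjugate of the kernel is the resolvent of the constant 1 at conj(z), whose mean
    [hardy_resolvent] computes. *)
Lemma mean_ckernel z : normc z < 1 -> mean (ckernel z) = 1.
Proof.
move=> z1; have zJ1 : normc (z^*)%C < 1 by rewrite normcJ.
have [[k2 _] m] := hardy_resolvent zJ1 (hardy_cst 1).
rewrite mean_cst in m.
rewrite -[mean _]conjcK -meanJ; last first.
  have := L2_L1 (L2_ckernel z1 (L2_cst 1)); by under eq_fun do rewrite mul1r.
rewrite (@eq_mean _ _ (fun t => 1 * (1 - (z^*)%C * eT t)^-1)) ?m ?conjc1// => t _.
by rewrite ckernelJ mul1r.
Qed.

(** With k the kernel and E = e^(-it), the induction step is the identity k E^N - E^N = z k
    E^(N+1). *)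
Lemma cauchy_remainder f z N : normc z < 1 -> L2 f ->
  cauchy f z - \sum_(0 <= n < N) mean (fun t => f t * (eT t)^-1 ^+ n) * z ^+ n =
  z ^+ N * mean (fun t => (f t * ckernel z t) * (eT t)^-1 ^+ N).
Proof.
move=> z1 f2; elim: N => [|N ih].
  by rewrite big_geq// subr0 expr0 mul1r; apply: eq_mean => t _; rewrite expr0 mulr1.
rewrite big_nat_recr//= opprD addrA ih exprSr -mulrA [X in _ - X]mulrC -mulrBr; congr (_ * _).
rewrite -meanZ; last exact/L2_L1/L2_eTVX/L2_ckernel.
rewrite -meanB; [|exact/L2_L1/L2_eTVX/L2_ckernel|exact/L2_L1/L2_eTVX].
apply: eq_mean => t _; rewrite exprS /ckernel.
by field; rewrite eT_neq0 ckernel_unit'.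
Qed.

Lemma cauchy_remainder_le f z N : normc z < 1 -> L2 f ->
  normc (cauchy f z - \sum_(0 <= n < N) mean (fun t => f t * (eT t)^-1 ^+ n) * z ^+ n) ^+ 2
  <= (normc z ^+ 2) ^+ N * ((1 - normc z)^-1 ^+ 2 * nrm2 f).
Proof.
move=> z1 f2; rewrite cauchy_remainder// Normc.normcM exprMn normcX exprAC.
rewrite ler_wpM2l ?exprn_ge0 ?normc_ge0//.
have := @normc_mean_bounded (fun t => f t * ckernel z t) _ 1 (cmeas_eTVX N).
rewrite expr1n mul1r => h; apply: le_trans (h _ _) _.
- by move=> t _; rewrite normc_eTVX.
- exact: L2_ckernel.
- apply: nrm2M_bounded => //; first exact: cmeas_ckernel.
  by move=> t _; exact: normc_ckernel.
Qed.

(* With v the quotient, e^n v has mean z times that of e^(n-1) v, and v has mean 0. *)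
Lemma hardy_difference_quotient f z : normc z < 1 -> hardy f ->
  hardy (fun t => (f t - cauchy f z) * ckernel z t) /\
  mean (fun t => (f t - cauchy f z) * ckernel z t) = 0.
Proof.
move=> z1 hf; set v := fun t => _.
have [d2 hd] := hardyB hf (hardy_cst (cauchy f z)).
have v2 : L2 v by exact: L2_ckernel.
have v0 : mean v = 0.
  rewrite /v; under [X in mean X]eq_fun do rewrite mulrBl.
  rewrite meanB ?meanZ ?mean_ckernel ?mulr1 ?subrr//.
  - have := L2_L1 (L2_ckernel z1 (L2_cst 1)); by under eq_fun do rewrite mul1r.
  - exact/L2_L1/L2_ckernel/hardy_L2.
  - exact/L2_L1/L2_ckernel/L2_cst.
have vX n : mean (fun t => v t * eT t ^+ n) = 0.
  elim: n => [|n ih]; first by under [X in mean X]eq_fun do rewrite expr0 mulr1.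
  have := hd n; rewrite (_ : mean _ = mean (fun t => v t * eT t ^+ n.+1) -
    z * mean (fun t => v t * eT t ^+ n)); first by rewrite ih mulr0 subr0.
  rewrite -meanZ; last exact/L2_L1/L2_eTX.
  rewrite -meanB; [|exact/L2_L1/L2_eTX|exact/L1Z/L2_L1/L2_eTX].
  apply: eq_mean => t _; rewrite /v exprS /ckernel.
  by field; rewrite eT_neq0 ckernel_unit'.
by split => //; split.
Qed.

(** The Poisson kernel (1 - |z|^2) / |e^(it) - z|^2, in a form that shows its sign; [poissonE] is
    the form in which means are computed. *)
Definition poisson z (t : R) : R := (1 - normc z ^+ 2) * normc (ckernel z t) ^+ 2.

Lemma poissonE z (t : R) : normc z < 1 ->
  ((poisson z t)%:C)%C = ckernel z t + ((ckernel z t)^*)%C - 1.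
Proof.
move=> z1; have h1 := ckernel_unit' t z1.
have h2 : 1 - (z^*)%C * eT t != 0.
  by have [] := @normc_resolvent (z^*)%C (eT t) _ (normc_eT t); rewrite ?normcJ.
rewrite /poisson (_ : _%:C%C = (1 - z * (z^*)%C) * (ckernel z t * ((ckernel z t)^*)%C)).
  by rewrite ckernelJ /ckernel; field; rewrite eT_neq0 h1 h2.
by rewrite !mulcJ; apply: eqc; rewrite !ReImE/=; ring.
Qed.

Lemma poisson_ge0 z (t : R) : normc z < 1 -> 0 <= poisson z t.
Proof.
by move=> z1; rewrite mulr_ge0 ?sqr_ge0// subr_ge0 expr_le1 ?normc_ge0// ltW.
Qed.

(** Of the three terms of [poissonE], the conjugate kernel contributes the mean of f by
    [hardy_resolvent], which cancels against the term - 1. The positive kernel of mean 1 makes it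
    possible to bound values in D by boundary values without losing a constant. *)
Lemma cauchy_poisson f z : normc z < 1 -> hardy f ->
  cauchy f z = mean (fun t => f t * ((poisson z t)%:C)%C).
Proof.
move=> z1 hf; have zJ1 : normc (z^*)%C < 1 by rewrite normcJ.
have [[k2 _] m] := hardy_resolvent zJ1 hf.
under [X in _ = mean X]eq_fun do rewrite poissonE// mulrBr mulrDr mulr1 ckernelJ.
rewrite meanB ?meanD//; [|exact/L2_L1/L2_ckernel/hardy_L2|exact: L2_L1| |exact/L2_L1/hardy_L2].
  by rewrite m addrK.
by apply: L1D; [exact/L2_L1/L2_ckernel/hardy_L2|exact: L2_L1].
Qed.

Lemma avg_poisson z : normc z < 1 -> avg (poisson z) = 1.
Proof.
move=> z1; have := cauchy_poisson z1 (hardy_cst 1); rewrite /cauchy.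
under [X in mean X = _]eq_fun do rewrite mul1r.
under [X in _ = mean X]eq_fun do rewrite mul1r.
by rewrite mean_ckernel// mean_real => -[].
Qed.

Lemma hardy_max f z M : normc z < 1 -> 0 <= M -> hardy f ->
  {ae mu, forall t, D t -> normc (f t) <= M} -> normc (cauchy f z) <= M.
Proof.
move=> z1 M0 hf fM; rewrite cauchy_poisson//.
have mp : measurable_fun D (poisson z).
  apply: measurable_funM; first exact: measurable_cst.
  by apply: cmeas_normc2; exact: cmeas_ckernel.
have ip : rint (poisson z).
  by have [_ k2] := L2_ckernel z1 (L2_cst 1); apply: rintZ; under eq_fun do rewrite -[ckernel z _]mul1r.
have f1 : L1 (fun t => f t * ((poisson z t)%:C)%C).
  apply: (@L1M_bounded _ _ _ ((1 - normc z ^+ 2) * (1 - normc z)^-1 ^+ 2)).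
  - exact: cmeas_real.
  - move=> t _; rewrite normc_real ger0_norm ?poisson_ge0//.
    apply: ler_wpM2l; first by rewrite subr_ge0 expr_le1 ?normc_ge0// ltW.
    by rewrite lerXn2r ?nnegrE ?normc_ge0 ?normc_ckernel// invr_ge0 subr_ge0 ltW.
  - exact/L2_L1/hardy_L2.
apply: le_trans (normc_mean_avg f1) _.
have mn : measurable_fun D (fun t => normc (f t)).
  by apply: cmeas_normc; case: hf => -[].
(* The bound on |f| holds only almost everywhere, while [le_avg] compares at every point; the
   truncation agrees with |f| almost everywhere and is at most M everywhere. *)
pose g t := Num.min (normc (f t)) M.
have mg : measurable_fun D g.
  by apply: measurable_minr => //; exact: measurable_cst.
rewrite (@ae_eq_avg _ _ (fun t => g t * poisson z t)); last 3 first.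
- by apply: cmeas_normc; exact: L1_meas.
- exact: measurable_funM.
- apply: (aeS fM) => t _ h; rewrite Normc.normcM normc_real ger0_norm ?poisson_ge0//.
  by rewrite /g min_l.
rewrite -[leRHS]mulr1 -(avg_poisson z1) -avgZ//; apply: le_avg.
- apply: (rint_dom _ (rint_normc f1)); first exact: measurable_funM.
  move=> t _; rewrite Normc.normcM normc_real normrM ler_wpM2r//.
  by rewrite ger0_norm /g ?ge_min ?lexx// le_min normc_ge0.
- exact: rintZ.
- move=> t _; rewrite ler_wpM2r ?poisson_ge0// /g.
  by rewrite ge_min lexx orbT.
Qed.

End Hardy.

(** The two sides differ by |e z - w|^2 / e. For small e the main term z keeps a factor close to
    1. *)
Lemma sqr_normcD_eta {R : realType} (z w : R[i]) (e : R) : 0 < e ->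
  Normc.normc (z + w) ^+ 2 <=
  (1 + e) * Normc.normc z ^+ 2 + (1 + e^-1) * Normc.normc w ^+ 2.
Proof.
move=> e0; rewrite !sqr_normc !ReImE -subr_ge0.
set a := complex.Re z; set b := complex.Im z; set c := complex.Re w; set d := complex.Im w.
have -> : (1 + e) * (a ^+ 2 + b ^+ 2) + (1 + e^-1) * (c ^+ 2 + d ^+ 2) -
  ((a + c) ^+ 2 + (b + d) ^+ 2) = e^-1 * ((e * a - c) ^+ 2 + (e * b - d) ^+ 2).
  by field; rewrite gt_eqF.
by rewrite mulr_ge0 ?invr_ge0 ?(ltW e0)// addr_ge0 ?sqr_ge0.
Qed.

(** * The extremal problem and the outer function *)

Section OuterFunction.
Context {R : realType}.
Local Notation C := R[i].
Local Notation normc := (@Normc.normc R).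
Local Notation mu := (@lebesgue_measure R).
Local Notation D := (@Tdom R).
Local Notation Re := (@complex.Re R).
Local Notation Im := (@complex.Im R).
Local Notation rint g := (mu.-integrable D (EFin \o g)).
Implicit Types (f g h k v : R -> C) (u : R -> R) (c z : C) (M x q : R).

Lemma nrm2D_eta f g e : L2 f -> L2 g -> 0 < e ->
  nrm2 (fun t => f t + g t) <= (1 + e) * nrm2 f + (1 + e^-1) * nrm2 g.
Proof.
move=> f2 g2 e0; have [_ fg] := L2D f2 g2; case: f2 g2 => mf f2 [mg g2].
rewrite /nrm2 -!avgZ// -avgD//; try exact: rintZ.
apply: le_avg => //; first by apply: rintD; exact: rintZ.
by move=> t _; exact: sqr_normcD_eta.
Qed.

Lemma parallelogram f g : L2 f -> L2 g ->
  nrm2 (fun t => f t - g t) = 2 * nrm2 f + 2 * nrm2 g - nrm2 (fun t => f t + g t).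
Proof.
move=> f2 g2; rewrite (nrm2D f2 g2) (nrm2D f2 (L2N g2)) nrm2N.
rewrite (_ : mean (fun t => f t * ((- g t)^*)%C) = - mean (fun t => f t * ((g t)^*)%C)).
  by rewrite ReN; lra.
rewrite -meanN; last exact: L1MJ.
by apply: eq_mean => t _; rewrite rmorphN mulrN.
Qed.

(** Pairing with a bounded function is continuous in L^2, so vanishing moments and prescribed means
    survive L^2 limits. In the proof, M^2 + 1 replaces M^2 to allow the division. *)
Lemma mean_cvg_eq (F : nat -> R -> C) f g c M : (forall n, L2 (F n)) -> L2 f ->
  (forall e, 0 < e -> exists N, forall n, (N <= n)%N -> nrm2 (fun t => F n t - f t) <= e) ->
  cmeas g -> (forall t, D t -> normc (g t) <= M) ->
  (forall n, mean (fun t => F n t * g t) = c) -> mean (fun t => f t * g t) = c.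
Proof.
move=> F2 f2 Ff mg gM Fc; apply/eqP; rewrite -subr_eq0 -normc_eq0 -sqrf_eq0.
rewrite eq_le sqr_ge0 andbT; apply/ler_addgt0Pr => e e0; rewrite add0r.
have M0 : 0 < M ^+ 2 + 1 by rewrite ltr_wpDl ?sqr_ge0.
have [N /(_ N (leqnn N)) hN] := Ff (e / (M ^+ 2 + 1)) (divr_gt0 e0 M0).
have B2 := L2B (F2 N) f2.
rewrite -(Fc N) -meanB; [|exact/L2_L1/(L2M_bounded mg gM)..].
rewrite -[X in normc X]opprK -meanN ?normcN; last first.
  by apply: L1B; exact/L2_L1/(L2M_bounded mg gM).
under [X in mean X]eq_fun do rewrite -mulrBl -mulNr opprB.
apply: le_trans (normc_mean_bounded mg gM B2) _.
apply: le_trans (_ : (M ^+ 2 + 1) * (e / (M ^+ 2 + 1)) <= _); last first.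
  by rewrite mulrC divfK// gt_eqF.
by apply: ler_pM; rewrite ?sqr_ge0 ?nrm2_ge0//; lra.
Qed.

Variables (W : R -> R) (delta : R).
Hypothesis mW : measurable_fun D W.
Hypothesis delta0 : 0 < delta.
Hypothesis W0 : forall t, 0 <= W t.
Hypothesis Wdelta : forall t, delta <= W t ^+ 2.
Hypothesis W1 : forall t, W t ^+ 2 <= 1.

(** [W] is the square root of the weight w, so that [energy] is the plain norm of a product and the
    lemmas on [nrm2] apply to it. *)
Definition weighted f : R -> C := fun t => ((W t)%:C)%C * f t.
Definition energy f := nrm2 (weighted f).

Let normcW t : normc ((W t)%:C)%C <= 1.
Proof. by rewrite normc_real ger0_norm// -(@expr_le1 _ 2) ?W0. Qed.

Lemma L2_weight f : L2 f -> L2 (weighted f).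
Proof.
rewrite /weighted => f2; under eq_fun do rewrite mulrC.
by apply: (@L2M_bounded _ _ _ 1) => // t _; exact: normcW.
Qed.

Lemma weight_ge f : L2 f -> delta * nrm2 f <= energy f.
Proof.
move=> f2; have [_ w2] := L2_weight f2; case: f2 => mf f2.
rewrite /energy /nrm2 -avgZ//; apply: le_avg => //; first exact: rintZ.
move=> t _; rewrite /weighted Normc.normcM exprMn ler_wpM2r ?sqr_ge0//.
by rewrite normc_real real_normK ?num_real.
Qed.

Lemma weight_le f : L2 f -> energy f <= nrm2 f.
Proof.
move=> f2; rewrite /energy /weighted -[leRHS]mul1r -[X in X * _](expr1n _ 2).
under [X in nrm2 X]eq_fun do rewrite mulrC.
by apply: nrm2M_bounded => // t _; exact: normcW.
Qed.

Definition competitor k := hardy k /\ mean k = 1.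

(** The midpoint of two near-minimisers is again a competitor, so the parallelogram law bounds their
    weighted distance. The lower bound [delta] on the weight makes a minimising sequence Cauchy in
    the plain norm, and [mean_cvg_eq] shows that the limit is a competitor. *)
Lemma minimizer_exists : exists2 h, competitor h & forall k, competitor k -> energy h <= energy k.
Proof.
pose S := [set energy k | k in competitor].
have S0 : S !=set0.
  exists (energy (fun=> 1)), (fun=> 1) => //; split; [exact: hardy_cst|exact: mean_cst].
have lbS : lbound S 0 by move=> _ [k _ <-]; exact: nrm2_ge0.
have hiS : has_inf S by split => //; exists 0.
pose d := inf S.
have dJ k : competitor k -> d <= energy k.
  by move=> hk; apply: ge_inf; [case: hiS|exists k].
have /choice[F hF] (n : nat) : exists k, competitor k /\ energy k < d + n.+1%:R^-1.
  have [_ [k hk <-] hJ] := @inf_adherent R S n.+1%:R^-1 (ltac:(by rewrite invr_gt0)) hiS.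
  by exists k.
have F2 n : L2 (F n) by have [[[]]] := hF n.
have FJ n : energy (F n) <= d + n.+1%:R^-1 by have [_ /ltW] := hF n.
have diff m n : delta * nrm2 (fun t => F m t - F n t) <= 2 * m.+1%:R^-1 + 2 * n.+1%:R^-1.
  apply: le_trans (weight_ge (L2B (F2 m) (F2 n))) _.
  have -> : energy (fun t => F m t - F n t) = nrm2 (fun t => weighted (F m) t - weighted (F n) t).
    by apply: eq_nrm2 => t _; rewrite /weighted mulrBr.
  rewrite parallelogram; try exact: L2_weight.
  have [[[hm m1] _] [[hn n1] _]] := (hF m, hF n).
  have mid : competitor (fun t => 2^-1 * (F m t + F n t)).
    split; first by apply: hardyZ; exact: hardyD.
    rewrite meanZ; last by apply: L1D; exact: L2_L1.
    by rewrite meanD ?m1 ?n1; [field|exact: L2_L1..].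
  have := dJ _ mid.
  have -> : energy (fun t => 2^-1 * (F m t + F n t)) = nrm2 (fun t => weighted (F m) t + weighted (F n) t) / 4.
    rewrite (_ : energy _ = nrm2 (fun t => 2^-1 * (weighted (F m) t + weighted (F n) t))).
      rewrite nrm2Z; last by apply: L2D; exact: L2_weight.
      rewrite mulrC Normc.normcV exprVn (_ : 2 = ((2 : R)%:C)%C :> C); last by rewrite rmorph_nat.
      by rewrite normc_real real_normK ?num_real// -natrX.
    by apply: eq_nrm2 => t _; rewrite /weighted mulrCA mulrDr.
  have := FJ m; have := FJ n; rewrite -![nrm2 (weighted _)]/(energy _).
  move: (energy (F m)) (energy (F n)) (nrm2 (fun t => weighted (F m) t + weighted (F n) t)) => a b x.
  by move: (m.+1%:R^-1) (n.+1%:R^-1) => p q; lra.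
have small e : 0 < e -> exists N, forall n, (N <= n)%N -> n.+1%:R^-1 <= e :> R.
  move=> e0; exists (Num.bound e^-1) => n hn; rewrite invf_ple ?posrE//.
  apply: ltW; apply: lt_le_trans (archi_boundP _) _; first by rewrite invr_ge0 ltW.
  by rewrite ler_nat (leq_trans hn).
have [h h2 Fh] : exists2 f, L2 f & forall e, 0 < e -> exists N, forall n, (N <= n)%N ->
    nrm2 (fun t => F n t - f t) <= e.
  apply: L2_complete => // e e0.
  have [N hN] := small (delta * e / 4) (ltac:(by rewrite divr_gt0 ?mulr_gt0)).
  exists N => m n /hN hm /hN hn; rewrite -(ler_pM2l delta0).
  apply: le_trans (diff m n) _; move: hm hn.
  by move: (m.+1%:R^-1) (n.+1%:R^-1) (delta * e) => p q r; lra.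
have ch : competitor h.
  split; first split => // n.
    apply: (@mean_cvg_eq F _ _ _ 1) => //; first exact: cmeas_eTX.
      by move=> t _; rewrite normc_eTX.
    by move=> m; have [[[_ ->]]] := hF m.
  transitivity (mean (fun t => h t * 1)); first by apply: eq_mean => t _; rewrite mulr1.
  apply: (@mean_cvg_eq F h (fun=> 1) 1 1 F2 h2 Fh (cmeas_cst 1)).
    by move=> t _; rewrite Normc.normc1.
  move=> n; have [[_ h1n] _] := hF n; by rewrite -[RHS]h1n; apply: eq_mean => t _; rewrite mulr1.
have d0 : 0 <= d by apply: lb_le_inf => // x /lbS.
suff Jh : energy h <= d by (exists h => // k hk; exact: le_trans Jh (dJ _ hk)).
(* As the weight is at most 1, convergence in the plain norm makes the energy of h - F n small;
   [nrm2D_eta] then compares h with F n at the cost of a factor 1 + e, which is sent to 1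
   afterwards. *)
have key e : 0 < e -> energy h <= (1 + e) * d.
  move=> e0; apply/ler_addgt0Pr => q q0.
  have q2 : 0 < q / 2 / (1 + e) by rewrite !divr_gt0//; lra.
  have q3 : 0 < q / 2 / (1 + e^-1) by rewrite !divr_gt0// addr_gt0 ?invr_gt0.
  have [N1 hN1] := small _ q2; have [N2 hN2] := Fh _ q3.
  pose n := maxn N1 N2.
  have := hN1 n (leq_maxl _ _); have := hN2 n (leq_maxr _ _).
  have B2 := L2B h2 (F2 n).
  rewrite nrm2_sub => b1 b2.
  have -> : energy h = nrm2 (fun t => weighted (F n) t + weighted (fun t => h t - F n t) t).
    by apply: eq_nrm2 => t _; rewrite /weighted -mulrDr addrC subrK.
  apply: le_trans (nrm2D_eta (L2_weight (F2 n)) (L2_weight B2) e0) _.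
  have {}b1 : (1 + e^-1) * energy (fun t => h t - F n t) <= q / 2.
    rewrite mulrC -ler_pdivlMr ?addr_gt0 ?invr_gt0//.
    by apply: le_trans b1; exact: weight_le.
  have {}b2 : (1 + e) * energy (F n) <= (1 + e) * d + q / 2.
    have e1 : 0 < 1 + e by lra.
    apply: le_trans (ler_wpM2l (ltW e1) (FJ n)) _.
    by rewrite mulrDr lerD2l mulrC -ler_pdivlMr.
  by rewrite -![nrm2 (weighted _)]/(energy _); lra.
apply/ler_addgt0Pr => e e0.
have := key (e / (d + 1)) (ltac:(by rewrite divr_gt0//; lra)).
move=> /le_trans; apply; rewrite mulrDl mul1r lerD2l -mulrAC ler_pdivrMr; nra.
Qed.

Lemma minimizer_orthogonal h : competitor h -> (forall k, competitor k -> energy h <= energy k) ->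
  forall v, hardy v -> mean v = 0 -> mean (fun t => weighted h t * ((weighted v t)^*)%C) = 0.
Proof.
move=> [hh h1] hmin v hv v0; set m := mean _.
have h2 := hardy_L2 hh; have v2 := hardy_L2 hv.
have key s : 0 <= - 2 * s * normc m ^+ 2 + s ^+ 2 * normc m ^+ 2 * energy v.
  pose c := ((- s)%:C)%C * m.
  have ck : competitor (fun t => h t + c * v t).
    split; first by apply: hardyD => //; exact: hardyZ.
    by rewrite meanD ?meanZ ?v0 ?mulr0 ?addr0//; [exact: L2_L1..|exact/L1Z/L2_L1].
  have := hmin _ ck.
  have -> : energy (fun t => h t + c * v t) = nrm2 (fun t => weighted h t + c * weighted v t).
    by apply: eq_nrm2 => t _; rewrite /weighted mulrDr; congr (_ + _); rewrite mulrCA.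
  rewrite nrm2_variation; [|exact: L2_weight..]; rewrite -/m.
  rewrite (_ : Re _ = - s * normc m ^+ 2); last by rewrite /c sqr_normc !ReImE/=; ring.
  rewrite (_ : normc c ^+ 2 = s ^+ 2 * normc m ^+ 2); last first.
    by rewrite /c Normc.normcM normc_real exprMn real_normK ?num_real// sqrrN.
  by rewrite -!/(energy _); lra.
have Jv : 0 <= energy v by exact: nrm2_ge0.
(* For nonzero m the quadratic is negative as soon as 0 < s and s times [energy v] is below 2; the
   added 1 covers the case of energy 0. *)
have := key (energy v + 1)^-1; have m0 := sqr_ge0 (normc m).
have -> : - 2 * (energy v + 1)^-1 * normc m ^+ 2 + (energy v + 1)^-1 ^+ 2 * normc m ^+ 2 * energy v =
  - (normc m ^+ 2 * ((energy v + 2) / (energy v + 1) ^+ 2)).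
  by field; rewrite gt_eqF// ltr_wpDl.
rewrite oppr_ge0 pmulr_lle0 ?divr_gt0 ?exprn_gt0 ?ltr_wpDl//.
by move=> m1; apply/eqP; rewrite -normc_eq0 -sqrf_eq0 eq_le m1.
Qed.

(* [A] is the outer function of modulus [W], [s] its value at 0 and [h] is [s / A]. *)
Record outer_pair h A (s : R) : Prop := OuterPair {
  outer_gt0 : 0 < s;
  outer_competitor : competitor h;
  outer_minimal : forall k, competitor k -> s ^+ 2 <= energy k;
  outer_energy : energy h = s ^+ 2;
  outer_hardy : hardy A;
  outer_mean : mean A = (s%:C)%C;
  outer_orthogonal : forall v, hardy v -> mean v = 0 -> mean (fun t => A t * v t) = 0;
  outer_mul : {ae mu, forall t, D t -> A t * h t = (s%:C)%C};
  outer_norm : {ae mu, forall t, D t -> normc (A t) = W t} }.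

Lemma outer_pair_exists : exists h A s, outer_pair h A s.
Proof.
have [h ch hmin] := minimizer_exists.
have orth := minimizer_orthogonal ch hmin.
have [hh h1] := ch; have h2 := hardy_L2 hh; have wh2 := L2_weight h2.
have c0 : 0 < energy h.
  apply: lt_le_trans (weight_ge h2); apply: mulr_gt0 => //.
  by have := normc_mean_le h2; rewrite h1 Normc.normc1 expr1n; lra.
pose s := Num.sqrt (energy h).
have s0 : 0 < s by rewrite sqrtr_gt0.
have s2 : s ^+ 2 = energy h by rewrite sqr_sqrtr// ltW.
pose F t := ((normc (weighted h t) ^+ 2)%:C)%C.
have F1 : L1 F by apply: L1_real; case: wh2.
have FE t : F t = weighted h t * ((weighted h t)^*)%C by rewrite mulcJ.
(* Orthogonality to v = e^(i(n+1)t) h, whose mean is 0 because h is in H^2(D). As F is real,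
   conjugation gives the coefficients of the other sign. *)
have FX n : mean (fun t => F t * (eT t)^-1 ^+ n.+1) = 0.
  rewrite -(orth _ (hardy_eTX n.+1 hh) (hh.2 n)); apply: eq_mean => t _.
  by rewrite FE -mulrA -eT_conj -conjcX -conjcM /weighted mulrA.
have Fpos n : mean (fun t => F t * eT t ^+ n.+1) = 0.
  rewrite -[LHS]conjcK -meanJ; last first.
    apply: (@L1M_bounded _ _ _ 1) => //; first exact: cmeas_eTX.
    by move=> t _; rewrite normc_eTX.
  rewrite (@eq_mean _ _ (fun t => F t * (eT t)^-1 ^+ n.+1)) ?FX ?conjc0// => t _.
  by rewrite conjcM conjcX eT_conj /F conjc_real.
have mF : mean F = ((s ^+ 2)%:C)%C by rewrite /F mean_real s2.
have nF : no_fourier (fun t => F t - ((s ^+ 2)%:C)%C).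
  split; first by apply: L1B => //; exact: L1_cst.
  move=> n; under [X in mean X]eq_fun do rewrite mulrBl.
  rewrite meanB; [|exact: L1_eTz|apply: L1_eTz; exact: L1_cst].
  rewrite meanZ; last first.
    by have := L1_eTz n (@L1_cst R 1); under eq_fun do rewrite mul1r.
  case: n => [[|n]|n].
  - under [X in mean X - _]eq_fun do rewrite expr0z mulr1.
    by under [X in _ * mean X]eq_fun do rewrite expr0z; rewrite mean_cst mF mulr1 subrr.
  - under [X in mean X - _]eq_fun do rewrite -exprnP.
    by under [X in _ * mean X]eq_fun do rewrite -exprnP; rewrite Fpos mean_eTX mulr0 subr0.
  - under [X in mean X - _]eq_fun do rewrite NegzE -exprnN -exprVn.
    under [X in _ * mean X]eq_fun do rewrite NegzE -exprnN -exprVn.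
    rewrite FX sub0r; apply/eqP; rewrite oppr_eq0 mulf_eq0; apply/orP; right; apply/eqP.
    rewrite -[LHS]conjcK -meanJ; last first.
      apply: L2_L1; apply: (@L2_bounded _ _ 1); first exact: cmeas_eTVX.
      by move=> t _; rewrite normc_eTVX.
    rewrite (@eq_mean _ _ (fun t => @eT R t ^+ n.+1)) ?mean_eTX ?conjc0// => t _.
    by rewrite conjcX -eT_conj conjcK.
have Fc : {ae mu, forall t, D t -> normc (weighted h t) ^+ 2 = s ^+ 2}.
  apply: (aeS (fourier_unique nF)) => t _ /subr0_eq.
  by rewrite /F => -[].
pose A t := (s^-1%:C)%C * ((W t)%:C)%C * ((weighted h t)^*)%C.
have A2 : L2 A.
  rewrite /A; under eq_fun do rewrite -mulrA.
  apply: L2Z; have := L2_weight (L2J wh2); exact.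
have mA v : L2 v -> mean (fun t => A t * v t) =
    (s^-1%:C)%C * ((mean (fun t => weighted h t * ((weighted v t)^*)%C))^*)%C.
  move=> v2; have wv2 := L2_weight v2; rewrite -meanJ; last exact: L1MJ.
  rewrite -meanZ; last by apply: L1J; exact: L1MJ.
  apply: eq_mean => t _; rewrite /A (conjcM (weighted h t)) conjcK -!mulrA; congr (_ * _).
  by rewrite mulrCA.
have Aorth v : hardy v -> mean v = 0 -> mean (fun t => A t * v t) = 0.
  by move=> hv v0; rewrite mA ?orth ?conjc0 ?mulr0//; exact: hardy_L2.
(* The same orthogonality, now with v = e^(i(n+1)t) alone. *)
have hA : hardy A.
  split; first exact: A2.
  move=> n; apply: (Aorth (fun t => eT t ^+ n.+1)); last exact: mean_eTX.
  rewrite (_ : (fun t => eT t ^+ n.+1) = (fun t => 1 * eT t ^+ n.+1)).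
    by apply: hardy_eTX; exact: hardy_cst.
  by apply/funext => t; rewrite mul1r.
exists h, A, s; split; [exact: s0|exact: ch| |by rewrite s2|exact: hA| |exact: Aorth| |].
- by move=> k ck; rewrite s2 hmin.
(* A is orthogonal to h - 1, which has mean 0; hence the mean of A equals that of A h, namely
   [energy h] / s = s. *)
- have L1h : L2 (fun t => h t - 1) by apply: L2B => //; exact: L2_cst.
  have h10 : mean (fun t => h t - 1) = 0.
    by rewrite meanB ?h1 ?mean_cst ?subrr//; [exact: L2_L1|exact: L1_cst].
  have := Aorth _ (hardyB hh (hardy_cst 1)) h10.
  under [X in mean X]eq_fun do rewrite mulrBr mulr1.
  rewrite meanB; [|exact: L1M|exact: L2_L1] => /subr0_eq <-.
  rewrite mA// -nrm2E -/(energy h) -s2 conjc_real -rmorphM; congr (_%:C)%C.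
  by rewrite expr2 mulKf// gt_eqF.
- apply: (aeS Fc) => t _ h0.
  rewrite (_ : A t * h t = (s^-1 * normc (weighted h t) ^+ 2)%:C%C).
    by rewrite h0 expr2 mulKf// gt_eqF.
  transitivity ((s^-1)%:C%C * ((normc (weighted h t) ^+ 2)%:C)%C); last by rewrite -rmorphM.
  by rewrite -mulcJ /A /weighted; ring.
- apply: (aeS Fc) => t _ h0.
  have nw : normc (weighted h t) = s.
    by apply/eqP; rewrite -(@eqrXn2 _ 2) ?normc_ge0 ?(ltW s0)//; apply/eqP.
  rewrite /A !Normc.normcM normcJ nw !normc_real !ger0_norm ?invr_ge0 ?(ltW s0)//.
  by rewrite mulrAC mulVf ?mul1r// gt_eqF.
Qed.

End OuterFunction.

(** * Fourier series *)

Section TrigPoly.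
Context {R : realType}.
Local Notation C := R[i].
Local Notation normc := (@Normc.normc R).
Local Notation mu := (@lebesgue_measure R).
Local Notation D := (@Tdom R).
Local Notation Re := (@complex.Re R).
Local Notation Im := (@complex.Im R).
Implicit Types (f g h k v : R -> C) (u : R -> R) (c : nat -> C) (z : C) (M x q : R).

Definition coef f n : C := mean (fun t => f t * (eT t)^-1 ^+ n).

Lemma mean_eT_orth (k n : nat) : mean (fun t => @eT R t ^+ k * (eT t)^-1 ^+ n) = (k == n)%:R.
Proof.
have [kn|nk|->] := ltngtP k n.
- rewrite -[LHS]conjcK -meanJ; last first.
    apply: L2_L1; apply: L2_eTVX; apply: (@L2_bounded _ _ 1); first exact: cmeas_eTX.
    by move=> t _; rewrite normc_eTX.
  rewrite (@eq_mean _ _ (fun t => @eT R t ^+ (n - k).-1.+1)) ?mean_eTX ?conjc0//.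
  move=> t _; rewrite conjcM !conjcX conjc_inv eT_conj invrK prednK ?subn_gt0//.
  by rewrite exprB ?unitfE ?eT_neq0 1?ltnW// mulrC exprVn.
- rewrite (@eq_mean _ _ (fun t => @eT R t ^+ (k - n).-1.+1)) ?mean_eTX//.
  move=> t _; rewrite prednK ?subn_gt0//.
  by rewrite exprB ?unitfE ?eT_neq0 1?ltnW// exprVn.
- rewrite (@eq_mean _ _ (fun=> 1)) ?mean_cst// => t _.
  by rewrite exprVn mulfV// expf_neq0// eT_neq0.
Qed.

Definition trigpoly c N (t : R) : C := \sum_(0 <= n < N) c n * eT t ^+ n.

Lemma cmeas_sum N (F : nat -> R -> C) : (forall i, cmeas (F i)) ->
  cmeas (fun t => \sum_(0 <= i < N) F i t).
Proof.
move=> F1; elim: N => [|N ih].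
  by under eq_fun do rewrite big_geq//; exact: cmeas_cst.
by under eq_fun do rewrite big_nat_recr//=; exact: cmeasD.
Qed.

Lemma cmeas_trigpoly c N : cmeas (trigpoly c N).
Proof.
by apply: cmeas_sum => n; apply: cmeasM; [exact: cmeas_cst|exact: cmeas_eTX].
Qed.

Lemma normc_sum (F : nat -> C) N :
  normc (\sum_(0 <= n < N) F n) <= \sum_(0 <= n < N) normc (F n).
Proof.
elim: N => [|N ih]; first by rewrite !big_geq// Normc.normc0.
by rewrite !big_nat_recr//=; apply: le_trans (le_normcD _ _) _; rewrite lerD2r.
Qed.

Lemma normc_trigpoly c N t : normc (trigpoly c N t) <= \sum_(0 <= n < N) normc (c n).
Proof.
apply: le_trans (normc_sum _ _) _; apply: ler_sum => n _.
by rewrite Normc.normcM normc_eTX mulr1.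
Qed.

Lemma L2_trigpoly c N : L2 (trigpoly c N).
Proof.
by apply: L2_bounded (cmeas_trigpoly c N) _ => t _; exact: normc_trigpoly.
Qed.

Lemma mean_trigpolyM f c N : L2 f ->
  mean (fun t => trigpoly c N t * f t) =
  \sum_(0 <= n < N) c n * mean (fun t => f t * eT t ^+ n).
Proof.
move=> f2; have L i : L1 (fun t => c i * (f t * eT t ^+ i)) by exact/L1Z/L2_L1/L2_eTX.
transitivity (mean (fun t => \sum_(0 <= i < N) c i * (f t * eT t ^+ i))).
  apply: eq_mean => t _; rewrite /trigpoly mulr_suml; apply: eq_bigr => i _.
  by rewrite -mulrA [f t * _]mulrC.
rewrite (mean_sum N L).2; apply: eq_bigr => i _.
by rewrite meanZ//; exact/L2_L1/L2_eTX.
Qed.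

Lemma hardy_trigpoly c N : hardy (trigpoly c N).
Proof.
split; first exact: L2_trigpoly.
move=> n; rewrite mean_trigpolyM; last first.
  by apply: (@L2_bounded _ _ 1); [exact: cmeas_eTX|move=> t _; rewrite normc_eTX].
rewrite big1// => i _; under [X in mean X]eq_fun do rewrite -exprD addSn.
by rewrite mean_eTX mulr0.
Qed.

Lemma coef_trigpoly c N n : coef (trigpoly c N) n = if (n < N)%N then c n else 0.
Proof.
rewrite /coef mean_trigpolyM; last first.
  by apply: (@L2_bounded _ _ 1); [exact: cmeas_eTVX|move=> t _; rewrite normc_eTVX].
transitivity (\sum_(0 <= i < N) if i == n then c n else 0).
  apply: eq_bigr => i _; under [X in mean X]eq_fun do rewrite mulrC.
  by rewrite mean_eT_orth; case: eqP => [->|_]; rewrite ?mulr1 ?mulr0.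
rewrite -big_mkcond big_mkord; case: ifPn => nN.
  by rewrite (big_pred1 (Ordinal nN))//.
rewrite big1// => -[i /= iN] /eqP ie; by move: nN; rewrite -ie iN.
Qed.

Lemma conjc_sum (F : nat -> C) N :
  ((\sum_(0 <= n < N) F n)^*)%C = \sum_(0 <= n < N) ((F n)^*)%C.
Proof.
elim: N => [|N ih]; first by rewrite !big_geq// conjc0.
by rewrite !big_nat_recr//= conjcD ih.
Qed.

Lemma mean_mul_trigpolyJ f c N : L2 f ->
  mean (fun t => f t * ((trigpoly c N t)^*)%C) =
  \sum_(0 <= n < N) ((c n)^*)%C * coef f n.
Proof.
move=> f2; have L i : L1 (fun t => ((c i)^*)%C * (f t * (eT t)^-1 ^+ i)).
  exact/L1Z/L2_L1/L2_eTVX.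
transitivity (mean (fun t => \sum_(0 <= i < N) ((c i)^*)%C * (f t * (eT t)^-1 ^+ i))).
  apply: eq_mean => t _; rewrite /trigpoly conjc_sum mulr_sumr; apply: eq_bigr => i _.
  by rewrite conjcM conjcX eT_conj mulrCA.
rewrite (mean_sum N L).2; apply: eq_bigr => i _.
by rewrite meanZ//; exact/L2_L1/L2_eTVX.
Qed.

Lemma Re_sum (F : nat -> C) N : Re (\sum_(0 <= n < N) F n) = \sum_(0 <= n < N) Re (F n).
Proof.
elim: N => [|N ih]; first by rewrite !big_geq.
by rewrite !big_nat_recr//= ReD ih.
Qed.

Lemma nrm2_trigpoly c N : nrm2 (trigpoly c N) = \sum_(0 <= n < N) normc (c n) ^+ 2.
Proof.
transitivity (Re (nrm2 (trigpoly c N))%:C%C); first by [].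
rewrite nrm2E mean_mul_trigpolyJ; last exact: L2_trigpoly.
rewrite Re_sum big_nat [RHS]big_nat; apply: eq_bigr => n /andP[_ nN].
by rewrite coef_trigpoly nN mulrC mulcJ.
Qed.

Lemma nrm2_sub_trigpoly f c N : L2 f -> nrm2 (fun t => f t - trigpoly c N t) =
  nrm2 f - 2 * Re (\sum_(0 <= n < N) ((c n)^*)%C * coef f n) +
  \sum_(0 <= n < N) normc (c n) ^+ 2.
Proof.
move=> f2; have T2 := L2_trigpoly c N.
rewrite nrm2D ?nrm2N ?nrm2_trigpoly//; last exact: L2N.
rewrite (_ : mean (fun t => f t * ((- trigpoly c N t)^*)%C) =
  - mean (fun t => f t * ((trigpoly c N t)^*)%C)); last first.
  by rewrite -meanN; [apply: eq_mean => t _; rewrite rmorphN mulrN|exact: L1MJ].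
by rewrite mean_mul_trigpolyJ// ReN mulrN.
Qed.

(* [r = 1] gives Bessel's inequality, [r < 1] the norm convergence of Abel means. *)
Lemma nrm2_sub_abel f N (r : R) : L2 f -> 0 <= r <= 1 ->
  nrm2 (fun t => f t - trigpoly (fun n => coef f n * ((r ^+ n)%:C)%C) N t) <=
  nrm2 f - \sum_(0 <= n < N) normc (coef f n) ^+ 2 * r ^+ n.
Proof.
move=> f2 /andP[r0 r1]; rewrite nrm2_sub_trigpoly//; move: (coef f) => a; rewrite Re_sum.
rewrite (eq_bigr (fun n => normc (a n) ^+ 2 * r ^+ n)); last first.
  by move=> n _; rewrite sqr_normc !ReImE/=; ring.
rewrite mulr_sumr -addrA lerD2l.
rewrite -!sumrN -big_split; apply: ler_sum => n _.
have rn0 : 0 <= r ^+ n by rewrite exprn_ge0.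
have rn1 : r ^+ n <= 1 by rewrite exprn_ile1.
have -> : normc (a n * ((r ^+ n)%:C)%C) ^+ 2 = normc (a n) ^+ 2 * (r ^+ n) ^+ 2.
  by rewrite Normc.normcM normc_real (ger0_norm rn0) exprMn.
have := sqr_ge0 (normc (a n)); rewrite /=.
move: (normc _ ^+ 2) (r ^+ n) rn0 rn1 => x y y0 y1 x0.
have : 0 <= x * (y * (1 - y)) by rewrite !mulr_ge0// subr_ge0.
lra.
Qed.

Lemma bessel f N : L2 f -> \sum_(0 <= n < N) normc (coef f n) ^+ 2 <= nrm2 f.
Proof.
move=> f2; have := @nrm2_sub_abel f N 1 f2; rewrite ler01 lexx => /(_ isT).
move=> /(le_trans (nrm2_ge0 _)); rewrite subr_ge0.
by under eq_bigr do rewrite expr1n mulr1.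
Qed.

Lemma bounded_series_cauchy (a : nat -> R) M : (forall n, 0 <= a n) ->
  (forall N, \sum_(0 <= n < N) a n <= M) -> forall e, 0 < e ->
  exists N, forall m, (N <= m)%N -> \sum_(N <= n < m) a n <= e.
Proof.
move=> a0 aM e e0; pose S := range (fun N => \sum_(0 <= n < N) a n).
have hS : has_sup S.
  by split; [exists (\sum_(0 <= n < 0) a n), 0%N|exists M => _ [N _ <-]].
have [_ [N _ <-] hN] := sup_adherent e0 hS; exists N => m Nm.
have : \sum_(0 <= n < m) a n <= sup S by apply: ub_le_sup; [case: hS|exists m].
by rewrite (big_cat_nat (leq0n N) Nm)//=; move: hN; lra.
Qed.

(** By Bessel's inequality the partial sums are Cauchy, so they converge to some g in L^2. Since g
    has the same Fourier coefficients as f, [fourier_unique] identifies the two. *)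
Theorem parseval f : hardy f -> forall e, 0 < e -> exists N, forall n, (N <= n)%N ->
  nrm2 (fun t => f t - trigpoly (coef f) n t) <= e.
Proof.
move=> hf; have f2 := hardy_L2 hf; pose S := trigpoly (coef f).
have S2 n : L2 (S n) by exact: L2_trigpoly.
have diff m n : (n <= m)%N ->
    nrm2 (fun t => S m t - S n t) = \sum_(n <= i < m) normc (coef f i) ^+ 2.
  move=> nm; pose c i := if (n <= i)%N then coef f i else 0.
  rewrite (@eq_nrm2 _ _ (trigpoly c m)).
    rewrite nrm2_trigpoly (big_cat_nat (leq0n n) nm)//= big_nat big1 ?add0r.
      by apply: eq_big_nat => i /andP[ni _]; rewrite /c ni.
    by move=> i /andP[_ ni]; rewrite /c leqNgt ni Normc.normc0 expr0n.
  move=> t _; rewrite /S /trigpoly !(big_cat_nat (leq0n n) nm)//= addrAC subrr add0r.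
  rewrite [X in _ = X + _]big_nat [X in _ = X + _]big1 ?add0r.
    by apply: eq_big_nat => i /andP[ni _]; rewrite /c ni.
  by move=> i /andP[_ ni]; rewrite /c leqNgt ni mul0r.
have [g g2 Sg] : exists2 g, L2 g & forall e, 0 < e -> exists N, forall n, (N <= n)%N ->
    nrm2 (fun t => S n t - g t) <= e.
  apply: L2_complete => // e e0.
  have [N hN] := bounded_series_cauchy (fun n => sqr_ge0 _) (fun N => bessel N f2) e0.
  have key m n : (N <= n)%N -> (n <= m)%N -> nrm2 (fun t => S m t - S n t) <= e.
    move=> Nn nm; rewrite diff//; apply: le_trans (hN m (leq_trans Nn nm)).
    rewrite [leRHS](big_cat_nat Nn nm)//= lerDr sumr_ge0// => i _; exact: sqr_ge0.
  exists N => m n Nm Nn; have [nm|/ltnW mn] := leqP n m; first exact: key.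
  by rewrite nrm2_sub; exact: key.
have nof : no_fourier (fun t => f t - g t).
  split; first by apply: L2_L1; exact: L2B.
  move=> n; under [X in mean X]eq_fun do rewrite mulrBl.
  have f1 := L2_L1 f2; have g1 := L2_L1 g2.
  rewrite meanB; [|exact: L1_eTz|exact: L1_eTz].
  case: n => n; last first.
    under [X in mean X - _]eq_fun do rewrite NegzE -exprnN -exprVn.
    under [X in _ - mean X]eq_fun do rewrite NegzE -exprnN -exprVn.
    (* The shift makes every partial sum long enough to contain the term of index n + 1. *)
    rewrite (@mean_cvg_eq _ (fun j : nat => S (j + n.+2)%N) g _ (coef f n.+1) 1) ?subrr//.
    - by move=> e /Sg[N hN]; exists N => j Nj; apply: hN; exact: leq_trans (leq_addr _ _).
    - exact: cmeas_eTVX.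
    - by move=> t _; rewrite normc_eTVX.
    - move=> j; rewrite -/(coef (S _) n.+1) coef_trigpoly.
      by rewrite (leq_trans (ltnSn _) (leq_addl _ _)).
  under [X in mean X - _]eq_fun do rewrite -exprnP.
  under [X in _ - mean X]eq_fun do rewrite -exprnP.
  (* At least one term is kept, so that the constant coefficient is right from the start. *)
  rewrite (@mean_cvg_eq _ (fun j : nat => S j.+1) g _ (mean (fun t => f t * eT t ^+ n)) 1) ?subrr//.
  - by move=> e /Sg[N hN]; exists N => j Nj; apply: hN; exact: leq_trans (leqnSn _).
  - exact: cmeas_eTX.
  - by move=> t _; rewrite normc_eTX.
  - case: n => [|n] k; last by rewrite hf.2 (hardy_trigpoly _ _).2.
    have := coef_trigpoly (coef f) k.+1 0; rewrite {1}/coef/= => h.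
    transitivity (coef f 0); last by apply: eq_mean => t _; rewrite !expr0.
    by rewrite -h; apply: eq_mean => t _; rewrite !expr0.
have fg := fourier_unique nof.
move=> e /Sg[N hN]; exists N => n /hN; rewrite nrm2_sub; apply: le_trans.
rewrite le_eqVlt; apply/orP; left; apply/eqP; apply: ae_eq_avg.
- by apply: cmeas_normc2; case: (L2B f2 (S2 n)).
- by apply: cmeas_normc2; case: (L2B g2 (S2 n)).
- by apply: (aeS fg) => t _ /subr0_eq ->.
Qed.

End TrigPoly.

(** * Uniqueness of the outer function *)

Section Uniqueness.
Context {R : realType}.
Local Notation C := R[i].
Local Notation normc := (@Normc.normc R).
Local Notation mu := (@lebesgue_measure R).
Local Notation D := (@Tdom R).
Local Notation Re := (@complex.Re R).
Local Notation Im := (@complex.Im R).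
Local Notation rint g := (mu.-integrable D (EFin \o g)).
Implicit Types (f g h k v : R -> C) (z : C) (M x q : R) (p : {poly C}).

Lemma geometric_small q M e : 0 <= q < 1 -> 0 < e ->
  exists N, forall n, (N <= n)%N -> q ^+ n * M <= e.
Proof.
move=> /andP[q0 q1] e0.
have : q ^+ n * M @[n --> \oo] --> (0 : R).
  rewrite -[X in _ --> X](mul0r M); apply: cvgM; last exact: cvg_cst.
  by apply: cvg_expr; rewrite ger0_norm.
move/cvgrPdist_le => /(_ e e0)[N _ hN]; exists N => n /hN /=.
by rewrite sub0r normrN; apply: le_trans; exact: ler_norm.
Qed.

Lemma nrm2_sub_partial f N : L2 f -> nrm2 (fun t => f t - trigpoly (coef f) N t) =
  nrm2 f - \sum_(0 <= n < N) normc (coef f n) ^+ 2.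
Proof.
move=> f2; rewrite nrm2_sub_trigpoly// Re_sum.
rewrite (eq_bigr (fun n => normc (coef f n) ^+ 2)); first by lra.
by move=> n _; rewrite mulrC mulcJ.
Qed.

(** The polynomial is a partial sum of f(r z) with r < 1. Unlike the partial sums of f, those of f(r
    z) converge uniformly on the closed disc, so half of the lower bound m survives; r close to 1
    keeps the L^2 error small. *)
Lemma hardy_approx_poly f (m : R) : hardy f -> 0 < m ->
  (forall z, normc z < 1 -> m <= normc (cauchy f z)) ->
  forall e, 0 < e -> exists p, [/\ nrm2 (fun t => f t - p.[eT t]) <= e,
    p.[0] = mean f & forall z, normc z <= 1 -> m / 2 <= normc p.[z]].
Proof.
move=> hf m0 hm e e0; have f2 := hardy_L2 hf; pose B := nrm2 f.
have B0 : 0 <= B by exact: nrm2_ge0.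
have e2 : 0 < e / 2 by rewrite divr_gt0.
have [M /(_ M (leqnn M))] := parseval hf e2; rewrite nrm2_sub_partial// -/B => hM.
have MB : 0 < 2 * M.+1%:R * (B + 1) by rewrite !mulr_gt0 ?ltr0n//; lra.
(* The coefficients beyond M already account for at most e / 2. With r = 1 - q, Bernoulli gives r^M
   >= 1 - M q, so damping the first M coefficients costs at most M q B <= e / 2. The added units
   keep the denominator positive. *)
pose q := Num.min (1 / 2) (e / (2 * M.+1%:R * (B + 1))).
have q0 : 0 < q by rewrite lt_min divr_gt0//= divr_gt0.
have q2 : q <= 1 / 2 by rewrite ge_min lexx.
have qe : M%:R * q * B <= e / 2.
  have : q <= e / (2 * M.+1%:R * (B + 1)) by rewrite ge_min lexx orbT.
  rewrite ler_pdivlMr// => h; rewrite ler_pdivlMr//; apply: le_trans h.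
  rewrite -[M.+1%:R]natr1 -subr_ge0.
  have -> : q * (2 * (M%:R + 1) * (B + 1)) - M%:R * q * B * 2 = 2 * q * (M%:R + B + 1) by ring.
  by rewrite !mulr_ge0 ?(ltW q0)// !addr_ge0.
pose r := 1 - q; have r0 : 0 <= r by rewrite /r; lra.
have r1 : r < 1 by rewrite /r; lra.
have rr : 0 <= r ^+ 2 < 1 by rewrite sqr_ge0 expr_lt1.
have m2 : 0 < (m / 2) ^+ 2 by rewrite exprn_gt0// divr_gt0.
(* From N0 on, [cauchy_remainder_le] bounds the truncation error by m / 2 at all points of modulus
   at most r. *)
have [N0 hN0] := @geometric_small _ ((1 - r)^-1 ^+ 2 * B) _ rr m2.
pose N := (maxn N0 M).+1; have NM : (M <= N)%N by rewrite leqW// leq_maxr.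
pose c n := coef f n * ((r ^+ n)%:C)%C.
pose p := \poly_(n < N) c n.
have pE z : p.[z] = \sum_(0 <= n < N) c n * z ^+ n by rewrite horner_poly big_mkord.
have pr z : p.[z] = \sum_(0 <= n < N) coef f n * ((r%:C)%C * z) ^+ n.
  by rewrite pE; apply: eq_bigr => n _; rewrite exprMn -mulrA rmorphXn.
have plow z : normc z <= 1 -> m / 2 <= normc p.[z].
  move=> z1; pose w := (r%:C)%C * z.
  have wr : normc w <= r by rewrite /w Normc.normcM normc_real ger0_norm// ler_piMr.
  have w1 : normc w < 1 by exact: le_lt_trans r1.
  have := cauchy_remainder_le N w1 f2; rewrite -/(coef f) -pr => h.
  have {}h : normc (cauchy f w - p.[z]) <= m / 2.
    rewrite -(@ler_sqr _ (normc _)) ?nnegrE ?normc_ge0 ?(ltW (divr_gt0 m0 _))//.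
    apply: le_trans h _; apply: le_trans (hN0 N (leqW (leq_maxl _ _))).
    have r1' : 0 < 1 - r by lra.
    have w1' : 0 < 1 - normc w by lra.
    apply: ler_pM.
    - by rewrite exprn_ge0// sqr_ge0.
    - by rewrite mulr_ge0 ?sqr_ge0.
    - by rewrite lerXn2r ?nnegrE ?sqr_ge0// lerXn2r ?nnegrE ?normc_ge0.
    - rewrite ler_wpM2r// lerXn2r ?nnegrE ?invr_ge0 ?(ltW r1') ?(ltW w1')//.
      by rewrite lef_pV2// lerD2l lerN2.
  have := le_normcD (cauchy f w - p.[z]) p.[z]; rewrite subrK; have := hm _ w1; lra.
exists p; split => //.
- rewrite (@eq_nrm2 _ _ (fun t => f t - trigpoly c N t)); last by move=> t _; rewrite pE.
  apply: le_trans (@nrm2_sub_abel _ f N r f2 _) _; first by rewrite r0 ltW.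
  pose a n := normc (coef f n) ^+ 2 * r ^+ n.
  pose S1 := \sum_(0 <= n < M) a n; pose S2 := \sum_(M <= n < N) a n.
  have -> : \sum_(0 <= n < N) a n = S1 + S2 by exact: (big_cat_nat (leq0n M) NM).
  rewrite -/B.
  have S20 : 0 <= S2.
    by apply: sumr_ge0 => n _; rewrite mulr_ge0 ?sqr_ge0 ?exprn_ge0.
  pose S := \sum_(0 <= n < M) normc (coef f n) ^+ 2.
  have SB : S <= B by exact: bessel.
  have S0 : 0 <= S by apply: sumr_ge0 => n _; exact: sqr_ge0.
  have S1r : r ^+ M * S <= S1.
    rewrite /S /S1 mulr_sumr !big_nat; apply: ler_sum => n /andP[_ nM].
    rewrite /a [leLHS]mulrC; apply: ler_wpM2l; first exact: sqr_ge0.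
    by apply: ler_wiXn2l => //; [exact: ltW|exact: ltnW].
  have rM : 1 - M%:R * q <= r ^+ M by apply: bernoulli_le; apply/andP; split; lra.
  have h1 : (1 - M%:R * q) * S <= r ^+ M * S by rewrite ler_wpM2r.
  have h2 : M%:R * q * S <= M%:R * q * B by rewrite ler_wpM2l// mulr_ge0// ltW.
  move: hM; rewrite -/S mulrBl mul1r in h1 *; lra.
- rewrite pE big_nat_recl// big1 ?addr0.
    by rewrite /c !expr0 !mulr1 /coef; apply: eq_mean => t _; rewrite expr0 mulr1.
  by move=> i _; rewrite expr0n mulr0.
Qed.

(** All roots z have modulus above 1, and 1 / (e^(it) - z) is - 1 / z times the resolvent at 1 / z.
    Thus each linear factor is one application of [hardy_resolvent], which also tracks the mean. *)
Lemma hardy_inv_poly p : (forall z, normc z <= 1 -> p.[z] != 0) ->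
  hardy (fun t => (p.[eT t])^-1) /\ mean (fun t => (p.[eT t])^-1) = (p.[0])^-1.
Proof.
have [r pE] := closed_field_poly_normal p.
have factor (s : seq C) : (forall z, z \in s -> 1 < normc z) ->
    hardy (fun t => (\prod_(z <- s) (eT t - z))^-1) /\
    mean (fun t => (\prod_(z <- s) (eT t - z))^-1) = (\prod_(z <- s) (- z))^-1.
  elim: s => [|z s ih] hs.
    under eq_fun do rewrite big_nil invr1.
    by rewrite big_nil invr1 mean_cst; split => //; exact: hardy_cst.
  have z1 : 1 < normc z by apply: hs; rewrite inE eqxx.
  have z0 : z != 0 by rewrite -normc_gt0 (lt_trans _ z1).
  have [|h m] := ih; first by move=> w ws; apply: hs; rewrite inE ws orbT.
  have zV : normc z^-1 < 1 by rewrite Normc.normcV invf_lt1// (lt_trans _ z1).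
  have [h' m'] := hardy_resolvent zV h.
  have E t : (\prod_(w <- z :: s) (eT t - w))^-1 =
      - z^-1 * ((\prod_(w <- s) (eT t - w))^-1 * (1 - z^-1 * eT t)^-1).
    rewrite big_cons invfM mulrCA mulrC; congr (_ * _).
    have h0 : 1 - z^-1 * eT t != 0 by have [] := normc_resolvent zV (normc_eT t).
    have h1 : z - eT t != 0.
      by rewrite (_ : z - eT t = z * (1 - z^-1 * eT t)) ?mulf_neq0//; field.
    by field; rewrite h1 z0 -opprB oppr_eq0 h1.
  under eq_fun do rewrite E.
  split; first exact: hardyZ.
  by rewrite meanZ ?m' ?m ?big_cons ?invfM ?invrN//; exact/L2_L1/hardy_L2.
move=> p0; have pz0 : p.[0] != 0 by apply: p0; rewrite Normc.normc0.
have hr z : z \in r -> 1 < normc z.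
  move=> zr; rewrite ltNge; apply/negP => /p0/negP; apply.
  by rewrite pE hornerZ horner_prod (big_rem z zr)/= hornerXsubC subrr mul0r mulr0.
have [h m] := factor r hr.
have E (x : C) : (p.[x])^-1 = (lead_coef p)^-1 * (\prod_(z <- r) (x - z))^-1.
  rewrite {1}pE hornerZ horner_prod invfM; congr (_ * _^-1).
  by apply: eq_bigr => z _; rewrite hornerXsubC.
under eq_fun do rewrite E.
split; first exact: hardyZ.
rewrite meanZ ?m; last exact/L2_L1/hardy_L2.
by rewrite E; congr (_ * _^-1); apply: eq_bigr => z _; rewrite sub0r.
Qed.

End Uniqueness.

(** * Lower bound for the outer function, and comparison with a second solution G *)

Section OuterUnique.
Context {R : realType}.
Local Notation C := R[i].
Local Notation normc := (@Normc.normc R).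
Local Notation mu := (@lebesgue_measure R).
Local Notation D := (@Tdom R).
Local Notation Re := (@complex.Re R).
Local Notation Im := (@complex.Im R).
Variables (W : R -> R) (delta : R).
Hypothesis mW : measurable_fun D W.
Hypothesis delta0 : 0 < delta.
Hypothesis W0 : forall t, 0 <= W t.
Hypothesis Wdelta : forall t, delta <= W t ^+ 2.
Hypothesis W1 : forall t, W t ^+ 2 <= 1.
Variables (h A : R -> C) (s : R).
Hypothesis hAs : outer_pair W h A s.
Implicit Types (f g k v : R -> C) (z : C) (M x q : R).

Let hh : hardy h. Proof. by have [] := outer_competitor hAs. Qed.
Let s0 : 0 < s. Proof. exact: outer_gt0 hAs. Qed.

Lemma weight_gt0 t : 0 < W t.
Proof.
rewrite lt_def W0 andbT; apply/eqP => w0; have := Wdelta t.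
by rewrite w0 expr0n /= leNgt delta0.
Qed.

(** With k the Cauchy kernel, orthogonality to (h - h(z)) k reads mean (A h k) = h(z) A(z); since A
    h = s on the circle and k has mean 1, the left side is s. *)
Lemma outer_cauchy_mul z : normc z < 1 -> cauchy A z * cauchy h z = (s%:C)%C.
Proof.
move=> z1; have [hv v0] := hardy_difference_quotient z1 hh.
have A2 := hardy_L2 (outer_hardy hAs); have h2 := hardy_L2 hh.
have hk2 := L2_ckernel z1 h2; have Ak2 := L2_ckernel z1 A2.
have := outer_orthogonal hAs hv v0.
rewrite (@eq_mean _ _ (fun t => A t * (h t * ckernel z t) -
  cauchy h z * (A t * ckernel z t))); last by move=> t _; ring.
rewrite meanB; [|exact: (L1M A2 hk2)|exact: (L1Z _ (L2_L1 Ak2))].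
rewrite (meanZ _ (L2_L1 Ak2)) -/(cauchy A z) => /subr0_eq E.
rewrite mulrC -{}E; rewrite (@ae_eq_mean _ _ (fun t => (s%:C)%C * ckernel z t)).
- rewrite meanZ ?mean_ckernel ?mulr1//.
  by have := L2_L1 (L2_ckernel z1 (L2_cst 1)); under eq_fun do rewrite mul1r.
- by apply: cmeasM; [case: A2|case: hk2].
- by apply: cmeasM; [exact: cmeas_cst|exact: cmeas_ckernel].
- by apply: (aeS (outer_mul hAs)) => t _ <-; rewrite mulrA.
Qed.

Lemma outer_lower_bound z : normc z < 1 -> delta <= normc (cauchy A z) ^+ 2.
Proof.
move=> z1; have /(congr1 normc) := outer_cauchy_mul z1.
rewrite Normc.normcM normc_real gtr0_norm// => As.
pose M := s / Num.sqrt delta.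
have M0 : 0 < M by rewrite divr_gt0// sqrtr_gt0.
have M2 : M ^+ 2 = s ^+ 2 / delta by rewrite /M exprMn exprVn sqr_sqrtr// ltW.
have : normc (cauchy h z) <= M.
  apply: hardy_max => //; first exact: ltW.
  apply: (aeS (aeI (outer_mul hAs) (outer_norm hAs))) => t _ [/(congr1 normc) + AW].
  rewrite Normc.normcM normc_real gtr0_norm// AW => Wh.
  rewrite -ler_sqr ?nnegrE ?normc_ge0 ?(ltW M0)// M2 ler_pdivlMr// -Wh exprMn mulrC.
  by rewrite ler_wpM2r// sqr_ge0.
rewrite -ler_sqr ?nnegrE ?normc_ge0 ?(ltW M0)// M2 ler_pdivlMr// -As exprMn.
have : normc (cauchy h z) != 0.
  by apply/eqP => h0; move: As s0; rewrite h0 mulr0 => <-; rewrite ltxx.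
rewrite mulrC => h0; rewrite ler_pM2r// exprn_gt0// lt_def h0; exact: normc_ge0.
Qed.

Variables (G : R -> C) (g m : R).
Hypothesis hG : hardy G.
Hypothesis GW : {ae mu, forall t, D t -> normc (G t) = W t}.
Hypothesis Gmean : mean G = (g%:C)%C.
Hypothesis g0 : 0 < g.
Hypothesis m0 : 0 < m.
Hypothesis Gm : forall z, normc z < 1 -> m <= normc (cauchy G z).

(** The competitor is g / p with p from [hardy_approx_poly]. Its energy is that of g G / p without
    weight, and G / p = 1 + (G - p) / p is close to 1 because 1 / p is bounded independently of the
    approximation. *)
Let mean_le : s ^+ 2 <= g ^+ 2.
Proof.
have G2 := hardy_L2 hG.
have key e q : 0 < e -> 0 < q ->
    s ^+ 2 <= g ^+ 2 * ((1 + q) + (1 + q^-1) * ((m / 2)^-1 ^+ 2 * e)).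
  move=> e0 q0; have [p [pe p0 pm]] := hardy_approx_poly hG m0 Gm e0.
  have m2 : 0 < m / 2 by rewrite divr_gt0.
  have pn0 z : normc z <= 1 -> p.[z] != 0.
    by move=> z1; rewrite -normc_gt0; apply: lt_le_trans (pm _ z1).
  have [hp mp] := hardy_inv_poly pn0.
  have pV t : normc (p.[eT t])^-1 <= (m / 2)^-1.
    have eT1 : normc (@eT R t) <= 1 by rewrite normc_eT.
    rewrite Normc.normcV lef_pV2 ?posrE ?pm//.
    by rewrite normc_gt0 pn0.
  have p2 := hardy_L2 hp.
  pose k t := (g%:C)%C * (p.[eT t])^-1.
  have ck : competitor k.
    split; first exact: hardyZ.
    rewrite meanZ ?mp ?p0 ?Gmean; last exact: L2_L1.
    by rewrite mulfV// -normc_eq0 normc_real gtr0_norm// gt_eqF.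
  apply: le_trans (outer_minimal hAs ck) _.
  have Gp2 : L2 (fun t => G t * (p.[eT t])^-1).
    by apply: (@L2M_bounded _ _ _ (m / 2)^-1) => //; case: p2.
  have -> : energy W k = nrm2 (fun t => (g%:C)%C * (G t * (p.[eT t])^-1)).
    apply: ae_eq_avg.
    - apply: cmeas_normc2; apply: cmeasM; first exact: cmeas_real.
      by apply: cmeasM; [exact: cmeas_cst|case: p2].
    - by apply: cmeas_normc2; apply: cmeasM; [exact: cmeas_cst|case: Gp2].
    apply: (aeS GW) => t _ Gt.
    rewrite /weighted /k !Normc.normcM Gt normc_real ger0_norm//.
    by congr (_ ^+ 2); rewrite mulrCA.
  rewrite nrm2Z// normc_real real_normK ?num_real// ler_wpM2l ?sqr_ge0//.
  (* Measurability of p on the circle is read off from that of 1 / p by inverting twice; the bound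
     is the sum of the moduli of the coefficients. *)
  have d2 : L2 (fun t => G t - p.[eT t]).
    apply: L2B => //; rewrite (_ : (fun t => p.[eT t]) = (fun t => ((p.[eT t])^-1)^-1)).
      apply: (@L2_bounded _ _ (\sum_(0 <= i < size p) normc p`_i)).
        by apply: cmeasV; case: p2.
      move=> t _; rewrite invrK horner_coef -(big_mkord xpredT (fun i => p`_i * eT t ^+ i)).
      exact: normc_trigpoly.
    by apply/funext => t; rewrite invrK.
  have dp2 : L2 (fun t => (G t - p.[eT t]) * (p.[eT t])^-1).
    by apply: (@L2M_bounded _ _ _ (m / 2)^-1) => //; case: p2.
  rewrite (@eq_nrm2 _ _ (fun t => 1 + (G t - p.[eT t]) * (p.[eT t])^-1)); last first.
    move=> t _; have : p.[eT t] != 0 by apply: pn0; rewrite normc_eT.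
    by move=> n0; field.
  apply: le_trans (nrm2D_eta (L2_cst 1) dp2 q0) _.
  rewrite nrm2_cst Normc.normc1 expr1n mulr1 lerD2l.
  rewrite ler_wpM2l ?addr_ge0 ?invr_ge0 ?(ltW q0)//.
  apply: le_trans (_ : (m / 2)^-1 ^+ 2 * nrm2 (fun t => G t - p.[eT t]) <= _).
    by apply: nrm2M_bounded => //; case: p2.
  by rewrite ler_wpM2l ?sqr_ge0.
apply/ler_addgt0Pr => e e0.
(* The factor 1 + q of [nrm2D_eta] costs one q, and the approximation error q / K, multiplied by K,
   another: in total g^2 (1 + 2 q) = g^2 + e. *)
pose q := e / 2 / g ^+ 2; have g2 : 0 < g ^+ 2 by rewrite exprn_gt0.
have q0 : 0 < q by rewrite !divr_gt0.
pose K := (1 + q^-1) * (m / 2)^-1 ^+ 2.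
have K0 : 0 < K by rewrite mulr_gt0 ?addr_gt0 ?exprn_gt0 ?invr_gt0 ?divr_gt0.
have qK : 0 < q / K by rewrite divr_gt0.
apply: le_trans (key _ _ qK q0) _.
rewrite mulrA -/K mulrCA mulfV ?gt_eqF// mulr1.
suff -> : g ^+ 2 * (1 + q + q) = g ^+ 2 + e by [].
by rewrite /q; field; rewrite gt_eqF.
Qed.

(** A product of two functions in H^2(D) is a priori only integrable. For a Taylor polynomial of G
    in place of G, only the constant term contributes to the mean; Cauchy-Schwarz then passes to the
    limit. *)
Let mean_product : mean (fun t => G t * h t) = (g%:C)%C.
Proof.
have G2 := hardy_L2 hG; have h2 := hardy_L2 hh; have [_ h1] := outer_competitor hAs.
apply/eqP; rewrite -subr_eq0 -normc_eq0 -sqrf_eq0 eq_le sqr_ge0 andbT.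
apply/ler_addgt0Pr => e e0; rewrite add0r.
have B0 : 0 < nrm2 h + 1 by rewrite ltr_wpDl ?nrm2_ge0.
have [N /(_ N.+1 (leqnSn N)) hN] := parseval hG (divr_gt0 e0 B0).
have T2 := L2_trigpoly (coef G) N.+1.
have -> : (g%:C)%C = mean (fun t => trigpoly (coef G) N.+1 t * h t).
  rewrite mean_trigpolyM// big_nat_recl// big1 ?addr0.
    under [X in _ * mean X]eq_fun do rewrite expr0 mulr1.
    rewrite h1 mulr1 -Gmean; apply: eq_mean => t _; by rewrite expr0 mulr1.
  by move=> i _; rewrite hh.2 mulr0.
rewrite -meanB; [|exact: L1M|exact: L1M].
rewrite (@eq_mean _ _ (fun t => (G t - trigpoly (coef G) N.+1 t) * (((h t)^*)%C^*)%C)); last first.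
  by move=> t _; rewrite conjcK mulrBl.
apply: le_trans (CauchySchwarz (L2B G2 T2) (L2J h2)) _.
rewrite nrm2J; apply: le_trans (ler_wpM2r (nrm2_ge0 _) hN) _.
rewrite -mulrA ler_piMr ?(ltW e0)// ler_pdivrMl// mulr1; lra.
Qed.

Theorem outer_unique : {ae mu, forall t, D t -> G t = A t}.
Proof.
have G2 := hardy_L2 hG; have h2 := hardy_L2 hh.
have W1' t : W t <= 1 by rewrite -(@expr_le1 _ 2).
have Wd t : delta <= W t.
  by apply: le_trans (Wdelta t) _; rewrite expr2 ler_piMr.
(* Since |G| = W almost everywhere, this is W g / G, written so that the only division is by W,
   which is bounded below at every point. *)
pose V t := (g%:C)%C * (((G t)^*)%C * ((W t)%:C)%C^-1).
have cW : cmeas (fun t => (((W t)%:C)%C)^-1) by apply: cmeasV; exact: cmeas_real.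
have GW2 : L2 (fun t => ((G t)^*)%C * ((W t)%:C)%C^-1).
  apply: (@L2M_bounded _ _ _ delta^-1) => //; last exact: L2J.
  move=> t _; rewrite Normc.normcV normc_real ger0_norm// lef_pV2 ?posrE//.
  exact: weight_gt0.
have V2 : L2 V by exact: L2Z.
have wh2 : L2 (weighted W h) by exact: L2_weight.
have nV : nrm2 V = g ^+ 2.
  rewrite nrm2Z// normc_real real_normK ?num_real//.
  rewrite (_ : nrm2 _ = 1) ?mulr1// -[RHS](@avg_cst R 1); apply: ae_eq_avg.
  - by apply: cmeas_normc2; case: GW2.
  - exact: measurable_cst.
  apply: (aeS GW) => t _ Gt; rewrite Normc.normcM normcJ Gt Normc.normcV normc_real.
  by rewrite ger0_norm// mulfV ?expr1n// gt_eqF// weight_gt0.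
have cross : mean (fun t => weighted W h t * ((- V t)^*)%C) = - ((g ^+ 2)%:C)%C.
  rewrite (@eq_mean _ _ (fun t => - (g%:C)%C * (G t * h t))); last first.
    move=> t _; have w0 : ((W t)%:C)%C != 0 :> C.
      by rewrite -normc_eq0 normc_real normr_eq0 gt_eqF// weight_gt0.
    rewrite -[- V t]mulN1r !conjcM conjcK conjc_inv !conjc_real /weighted.
    rewrite (_ : ((-1)^*)%C = -1 :> C); last by apply: eqc; rewrite !ReImE/= ?oppr0.
    by field.
  by rewrite meanZ ?mean_product ?mulNr -?rmorphM//; exact: L1M.
have := nrm2D wh2 (L2N V2); rewrite nrm2N nV cross -/(energy W h) (outer_energy hAs) => E.
(* By E the squared distance of W h and V is s^2 - 2 g^2 + g^2, so g <= s; with [mean_le] the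
   distance is 0. *)
have sg : s ^+ 2 = g ^+ 2.
  apply/eqP; rewrite eq_le mean_le/=; have := nrm2_ge0 (fun t => weighted W h t - V t).
  by rewrite E /=; lra.
have {}sg : s = g by apply/eqP; rewrite -(@eqrXn2 _ 2) ?(ltW s0) ?(ltW g0)// sg.
have {}E : nrm2 (fun t => weighted W h t - V t) = 0 by rewrite E /= sg; lra.
have := nrm2_eq0 (L2B wh2 V2) E => WhV.
apply: (aeS (aeI WhV (aeI GW (outer_mul hAs)))) => t _ [/subr0_eq WV [Gt As]].
have w0 : ((W t)%:C)%C != 0 :> C.
  by rewrite -normc_eq0 normc_real normr_eq0 gt_eqF// weight_gt0.
have gn0 : (g%:C)%C != 0 :> C by rewrite -normc_eq0 normc_real normr_eq0 gt_eqF.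
have GJ0 : ((G t)^*)%C != 0 by rewrite -normc_eq0 normcJ Gt gt_eqF// weight_gt0.
have GG : G t * ((G t)^*)%C = ((W t)%:C)%C ^+ 2 by rewrite mulcJ Gt rmorphXn.
have hE : h t = (g%:C)%C * ((G t)^*)%C * (((W t)%:C)%C ^+ 2)^-1.
  by apply: (mulfI w0); rewrite -/(weighted W h t) WV /V; field.
apply: (mulIf GJ0); rewrite GG; apply: (mulfI gn0).
have {}As : A t * ((g%:C)%C * ((G t)^*)%C * (((W t)%:C)%C ^+ 2)^-1) = (g%:C)%C.
  by rewrite -hE As sg.
rewrite -[X in X * _ = _]As -!mulrA mulVf ?expf_neq0// mulr1.
by rewrite mulrCA.
Qed.

End OuterUnique.

(** * Functions on the unit circle of the complex plane *)

Section CircleFunctions.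
Context {R : realType}.
Local Notation C := R[i].
Local Notation normc := (@Normc.normc R).
Local Notation mu := (@lebesgue_measure R).
Local Notation D := (@Tdom R).
Local Notation Re := (@complex.Re R).
Local Notation Im := (@complex.Im R).
Implicit Types (F : C -> C) (z : C).

Lemma star_eT F (t : R) : star F (eT t) = ((F (eT t))^*)%C.
Proof. by rewrite /star; change ((F ((eT t)^*)%C^-1)^*%C = ((F (eT t))^*)%C); rewrite eT_conj invrK. Qed.

Lemma fourierE F (n : int) : fourier F n = mean (fun t => F (eT t) * eT (- (n%:~R * t))).
Proof.
rewrite /fourier -fmorphV; apply: eqc; rewrite !ReImE /= mulr0 ?subr0 ?add0r//.
Qed.

Lemma fourier_coef F n : fourier F n%:Z = coef (fun t => F (eT t)) n.
Proof. by rewrite fourierE; apply: eq_mean => t _; rewrite eTN eT_mulrn exprVn. Qed.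

Lemma fourier_neg F n : fourier F (Negz n) = mean (fun t => F (eT t) * eT t ^+ n.+1).
Proof.
rewrite fourierE; apply: eq_mean => t _.
by rewrite NegzE mulrNz mulNr opprK eT_mulrn.
Qed.

Lemma L2TP F : L2T F <-> L2 (fun t => F (eT t)).
Proof.
have nn : (\int[mu]_(x in D) `|(EFin \o (fun t => normc (F (eT t)) ^+ 2)%R) x|)%E =
    (\int[mu]_(t in D) (normc (F (eT t)) ^+ 2)%:E)%E.
  by apply: eq_integral => t _ /=; rewrite ger0_norm// sqr_ge0.
split=> [[mF iF]|[mF /integrableP[_]]]; last by rewrite nn; split.
split => //; apply/integrableP; split; last by rewrite nn.
by apply/measurable_EFinP; exact: cmeas_normc2.
Qed.

Lemma H2DP F : H2D F <-> hardy (fun t => F (eT t)).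
Proof.
split=> [[/L2TP F2 hF]|[F2 hF]].
  by split => // n; rewrite -fourier_neg hF.
by split; [exact/L2TP|case=> // n _; rewrite fourier_neg hF].
Qed.

Lemma cvg_normc_small (u : nat -> C) (l : C) : (forall e, 0 < e -> exists N, forall n,
    (N <= n)%N -> normc (l - u n) <= e) ->
  (Re (u n) @[n --> \oo] --> Re l) /\ (Im (u n) @[n --> \oo] --> Im l).
Proof.
move=> ul; split; apply/cvgrPdist_le => e e0; have [N hN] := ul _ e0;
  exists N => // n /hN; apply: le_trans; rewrite -?ReN -?ReD -?ImN -?ImD.
  exact: normRe.
exact: normIm.
Qed.

Lemma extD_cauchy F z : L2 (fun t => F (eT t)) -> normc z < 1 ->
  extD F z = cauchy (fun t => F (eT t)) z.
Proof.
move=> F2 z1; set f := fun t => _.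
have pE N : partial_ext F z N = \sum_(0 <= n < N) coef f n * z ^+ n.
  by apply: eq_bigr => n _; rewrite fourier_coef.
have [|cR cI] := @cvg_normc_small (partial_ext F z) (cauchy f z).
  move=> e e0; have z2 : 0 <= normc z ^+ 2 < 1 by rewrite sqr_ge0 expr_lt1// normc_ge0.
  have [N hN] := @geometric_small _ (normc z ^+ 2) ((1 - normc z)^-1 ^+ 2 * nrm2 f) _ z2 (exprn_gt0 2 e0).
  exists N => n /hN h; rewrite -ler_sqr ?nnegrE ?normc_ge0 ?(ltW e0)//.
  by apply: le_trans h; rewrite pE; exact: cauchy_remainder_le.
apply: eqc; rewrite /extD/=; first exact: (cvg_lim (@Rhausdorff R) cR).
exact: (cvg_lim (@Rhausdorff R) cI).
Qed.

Lemma cauchy0 (f : R -> C) : cauchy f 0 = mean f.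
Proof. by apply: eq_mean => t _; rewrite /ckernel mul0r subr0 invr1 mulr1. Qed.

Lemma normc_extDstar_Some F z :
  normc (extDstar F (Some z)) = normc (extD (star F) ((z^*)%C)^-1).
Proof. exact: normcJ. Qed.

Lemma normc_extDstar_None F : normc (extDstar F None) = normc (extD (star F) 0).
Proof. exact: normcJ. Qed.

Lemma normc_VJ z : 1 < normc z -> normc ((z^*)%C)^-1 < 1.
Proof. by move=> z1; rewrite Normc.normcV normcJ invf_lt1// (lt_trans _ z1). Qed.

(* Junk value [f 0] off the unit circle. *)
Definition circle_fun (f : R -> C) (z : C) : C :=
  f (xget 0 [set t | D t /\ eT t = z]).

Lemma circle_funE f (t : R) : D t -> circle_fun f (eT t) = f t.
Proof.
move=> Dt; rewrite /circle_fun; have := @xgetPex _ 0 [set s | D s /\ eT s = eT t].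
by case=> [|Ds /eT_inj ->//]; exists t.
Qed.

Lemma eq_cauchy (f g : R -> C) z : (forall t, D t -> f t = g t) -> cauchy f z = cauchy g z.
Proof. by move=> fg; apply: eq_mean => t Dt; rewrite fg. Qed.

Lemma eq_cmeas (f g : R -> C) : (forall t, D t -> f t = g t) -> cmeas f -> cmeas g.
Proof.
move=> fg [f1 f2]; split.
  by apply: eq_measurable_fun f1 => t /set_mem Dt; rewrite fg.
by apply: eq_measurable_fun f2 => t /set_mem Dt; rewrite fg.
Qed.

Lemma eq_hardy (f g : R -> C) : (forall t, D t -> f t = g t) -> hardy f -> hardy g.
Proof.
move=> fg [[mf f2] hf]; have mg := eq_cmeas fg mf; split.
  apply: (@L2_dom _ _ (fun t => normc (f t) ^+ 2)) => // t Dt.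
  by rewrite fg.
by move=> n; rewrite -(hf n); apply: eq_mean => t Dt; rewrite fg.
Qed.

(** [muT] is Lebesgue measure restricted to [Tdom], so a [muT]-null set becomes Lebesgue null after
    intersection with [Tdom]. A real number below x is extracted because the essential supremum
    could a priori be -oo. *)
Lemma ess_sup_muT (f : R -> R) (x : R) : (ess_sup (@muT R) (fun t => (f t)%:E) < x%:E)%E ->
  exists2 y, y < x & {ae mu, forall t, D t -> f t <= y}.
Proof.
have := ess_sup_ge (@muT R) (fun t => (f t)%:E); set y := ess_sup _ _ => ae_le yx.
have [r rx yr] : exists2 r : R, r < x & (y <= r%:E)%E.
  move: yx; case: y {ae_le} => [r| |] //; first by rewrite lte_fin; exists r.
  by move=> _; exists (x - 1); [rewrite gtrBl|exact: leNye].
exists r => //; have [N [mN N0 sN]] := ae_le.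
exists (N `&` D); split => //; first by apply: measurableI => //; exact: measurable_D.
move=> t /= /not_implyP[Dt fr]; split => //; apply: sN => /= fy; apply: fr.
by rewrite -lee_fin; exact: le_trans yr.
Qed.

End CircleFunctions.

(** * Existence and uniqueness of a for a given b *)

Unset Implicit Arguments. Set Strict Implicit. Set Printing Implicit Defensive.

Theorem theorem7p1 (R : realType) (b : R[i] -> R[i]) :
  measT b ->
  (ess_sup (@muT R) (fun t => ((Normc.normc (b (eT t))) ^+ 2)%:E) < (1 / 2)%:E)%E ->
  exists a : R[i] -> R[i],
    (measT a /\ inB a b) /\
    forall a' : R[i] -> R[i], measT a' -> inB a' b ->
      {ae @lebesgue_measure R, forall t, Tdom t -> a' (eT t) = a (eT t)}.
Proof.
move=> mb /ess_sup_muT[x x12 bx].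
(* Nothing is known about the sign of x; the maximum with 0 ensures [delta] <= 1. *)
pose delta := 1 - Num.max x 0.
have mx : Num.max x 0 < 1 / 2 by rewrite gt_max x12/=; lra.
have mx0 : 0 <= Num.max x 0 by rewrite le_max lexx orbT.
have d12 : 1 / 2 < delta by rewrite /delta; lra.
have d0 : 0 < delta by lra.
have d1 : delta <= 1 by rewrite /delta; lra.
(* Truncating at [delta] makes the bounds on the weight hold at every t; by [bx] it changes nothing
   almost everywhere. *)
pose w t := Num.max delta (1 - Normc.normc (b (eT t)) ^+ 2).
have wd t : delta <= w t by rewrite le_max lexx.
have w0 t : 0 <= w t by rewrite (le_trans (ltW d0)).
pose W t := Num.sqrt (w t).
have W2 t : W t ^+ 2 = w t by rewrite sqr_sqrtr.
have mW : measurable_fun (@Tdom R) W.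
  apply: (@measurableT_comp _ _ _ _ _ _ (@Num.sqrt R)).
    by apply: continuous_measurable_fun => y; exact: sqrt_continuous.
  apply: measurable_maxr; first exact: measurable_cst.
  apply: measurable_funB; first exact: measurable_cst.
  exact: (@cmeas_normc2 R (fun t => b (eT t)) mb).
have W0 t : 0 <= W t by exact: sqrtr_ge0.
have Wd t : delta <= W t ^+ 2 by rewrite W2.
have W1 t : W t ^+ 2 <= 1.
  by rewrite W2 ge_max d1 /= gerBl sqr_ge0.
have Wb : {ae @lebesgue_measure R, forall t, Tdom t -> W t ^+ 2 = 1 - Normc.normc (b (eT t)) ^+ 2}.
  apply: (aeS bx) => t _ bt; rewrite W2 /w max_r// /delta lerD2l lerN2.
  by rewrite le_max bt.
have [h [A [s hAs]]] := outer_pair_exists mW d0 W0 Wd W1.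
have hA := outer_hardy hAs.
(* On the circle [star] is conjugation, so [star a] coincides with A there. *)
pose a := circle_fun (fun t => ((A t)^*)%C).
have sa t : Tdom t -> A t = star a (eT t).
  by move=> Dt; rewrite star_eT /a circle_funE// conjcK.
have hsa : hardy (fun t => star a (eT t)) by exact: eq_hardy hA.
have ext z : Normc.normc z < 1 -> extD (star a) z = cauchy A z.
  move=> z1; rewrite extD_cauchy//; last exact: hardy_L2.
  by apply: eq_cauchy => t /sa.
exists a; split.
  split.
    apply: (@eq_cmeas R (fun t => ((A t)^*)%C)); last by apply: cmeasJ; case: hA => -[].
    by move=> t Dt; rewrite /a circle_funE.
  split.
    split; last split; last first.
    - rewrite /extDstar ext ?Normc.normc0// cauchy0 (outer_mean hAs).
      rewrite [X in 0 < X](_ : _ = (s%:C)%C); last exact: conjc_real.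
      by rewrite ltcR; exact: outer_gt0 hAs.
    - exact/H2DP.
    apply: (aeS (aeI Wb (outer_norm hAs))) => t Dt [Wt At].
    rewrite -(sa _ Dt) star_eT mulcJ /a circle_funE// mulrC mulcJ At Wt.
    by rewrite -rmorphD subrK.
  apply: lt_le_trans d12 _; apply: lb_le_inf.
    by exists (Normc.normc (extDstar a None) ^+ 2), None.
  move=> _ [[z|] z1 <-].
    have z2 := normc_VJ z1; rewrite normc_extDstar_Some ext//.
    exact: (outer_lower_bound d0 Wd hAs).
  rewrite normc_extDstar_None ext ?Normc.normc0//.
  by apply: (outer_lower_bound d0 Wd hAs); rewrite Normc.normc0.
move=> a' ma' [[ab [/H2DP hG ext0]] inf12].
pose G t := star a' (eT t); have G2 := hardy_L2 hG.
have extG z : Normc.normc z < 1 -> extD (star a') z = cauchy G z by exact: extD_cauchy.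
have GJ t : G t = ((a' (eT t))^*)%C by exact: star_eT.
have GW : {ae @lebesgue_measure R, forall t, Tdom t -> Normc.normc (G t) = W t}.
  apply: (aeS (aeI Wb ab)) => t _ [Wt].
  rewrite !star_eT !mulcJ -rmorphD => /(congr1 (@complex.Re R))/= E.
  apply/eqP; rewrite -(@eqrXn2 _ 2) ?normc_ge0// GJ normcJ Wt; apply/eqP; lra.
have [g g0 Gg] : exists2 g : R, 0 < g & mean G = (g%:C)%C.
  move: ext0; rewrite /extDstar extG ?Normc.normc0// cauchy0.
  change (0 < ((mean G)^*)%C -> exists2 g : R, 0 < g & mean G = (g%:C)%C).
  (* In the order of the complex numbers, being positive includes being real. *)
  rewrite ltcE !ReImE /= => /andP[/eqP I0 R0].
  exists (complex.Re (mean G)) => //; apply: eqc => //=; lra.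
have lbS : has_lbound [set Normc.normc (extDstar a' p) ^+ 2 | p in @Dstar R].
  by exists 0 => _ [p _ <-]; exact: sqr_ge0.
(* If |G|^2 >= 1/2, then |G| >= 1/2 as well; the cruder bound avoids a square root and is enough for
   [outer_unique]. *)
have Gm z : Normc.normc z < 1 -> 1 / 2 <= Normc.normc (cauchy G z).
  move=> z1; have : 1 / 2 <= Normc.normc (cauchy G z) ^+ 2.
    apply: le_trans (ltW inf12) _; apply: ge_inf => //; rewrite -extG//.
    have [->|z0] := eqVneq z 0; first by exists None => //; rewrite normc_extDstar_None.
    exists (Some ((z^*)%C)^-1).
      by rewrite /Dstar /= -/(Normc.normc _) Normc.normcV normcJ invf_gt1// normc_gt0.
    by rewrite normc_extDstar_Some conjc_inv conjcK invrK.
  have := normc_ge0 (cauchy G z); nra.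
have m0 : 0 < 1 / 2 :> R by lra.
apply: (aeS (outer_unique mW d0 W0 Wd W1 hAs hG GW Gg g0 m0 Gm)) => t Dt /= GA.
by rewrite /a circle_funE// -GA star_eT conjcK.
Qed.
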